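(* Let $\mathbf k$ be a field and $I$ a finite set with at least two elements. The cobar construction $\Omega(K)$ of the cocategory $K$ is a minimal resolution of the $\mathbf k$-linear category $\mathbf k\mathcal T_I$. That is, $\Omega(K)$ is, as a graded category, free on the dg graph $s^{-1}\overline K$, its differential sends generators to decomposable elements (sums of compositions of at least two generators), and the canonical functor of dg categories $\Omega(K)\to\mathbf k\mathcal T_I$ (identity on objects) induces a quasi-isomorphism $\Omega(K)(t,s)\to\mathbf k\mathcal T_I(t,s)$ for all objects $t,s$.
   Context: A tree is a non-empty connected oriented graph without loops such that each vertex has at least one incoming edge and exactly one outgoing edge; edges without source are leaves, one edge (the root edge) has no target, edges with both a source and a target vertex are internal; $E_t$ is the set of internal edges of $t$. A tree is reduced if every vertex has more than one incoming edge; an $I$-tree has its leaves in bijection with $I$. Objects of $\mathcal T_I$: reduced $I$-trees (up to isomorphism compatible with leaf labels). For $E\subset E_t$, $t/E$ is $t$ with the edges of $E$ contracted ($E_{t/E}=E_t\setminus E$). $\mathcal T_I(t,s)$ is a point if $s=t/E$ for some (unique) $E$, else empty. $\mathbf k\mathcal T_I$ has the same objects and morphism spaces $\mathbf k[\mathcal T_I(t,s)]$; the basis element of $\mathbf k\mathcal T_I(t,t/E)$ is denoted $E$. A dg graph is a map $\Gamma:\mathrm{Ob}\,\mathcal T_I\times\mathrm{Ob}\,\mathcal T_I\to\mathrm{dgvs}$ (differential graded vector spaces); $\overline\Gamma(t,s)=\Gamma(t,s)$ if $t\neq s$ and $0$ if $t=s$. A cocategory is defined as a category on the same objects with arrows of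 the structure maps reversed (coassociative, counital). The free category on $\Gamma$ is $\mathcal F(\Gamma)(t,t')=\bigoplus_{m\ge 0}\bigoplus_{t'=x_0,x_1,\dots,x_m=t}\Gamma(x_1,x_0)\otimes\Gamma(x_2,x_1)\otimes\dots\otimes\Gamma(x_m,x_{m-1})$, composition being concatenation (the $m=0$ term is the identity $\mathbf k$, present when $t=t'$). $K$ is the dg graph with $K(t,s)=\Lambda^{|E|}(\mathbf k[E])$ in degree $|E|$ if $s=t/E$, and $0$ otherwise, with zero differential. Its co-composition is $$\Delta(h)=1\otimes h+h\otimes1+\sum_{p=1}^{n-1}\sum_{\sigma\in \mathrm{Sh}_{p,n-p}}\epsilon(\sigma)\,e_{\sigma(1)}\wedge\dots\wedge e_{\sigma(p)}\otimes e_{\sigma(p+1)}\wedge\dots\wedge e_{\sigma(n)}$$ for $h=e_1\wedge\dots\wedge e_n\in K(t,t/E)$, $E=\{e_1,\dots,e_n\}$, where $\mathrm{Sh}_{p,n-p}$ is the set of $(p,n-p)$-shuffles, $\epsilon$ the signature; the right-hand factor lies in $K(t,t/G)$ and the left-hand one in $K(t/G,t/E)$ with $G=\{e_{\sigma(p+1)},\dots,e_{\sigma(n)}\}$. The cobar construction $\Omega(R)$ of a cocategory $R$ is the free category $\mathcal F(s^{-1}\overline R)$ ($s^{-1}$ lowers degree by $1$) with the unique derivation extending the (reduced) co-composition; for $R=K$ it is determined on generators by $$\partial(s^{-1}\alpha)=\sum(-1)^{|\alpha_{(1)}|+1}s^{-1}\alpha_{(1)}\otimes s^{-1}\alpha_{(2)}$$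 (reduced co-composition in Sweedler notation). The canonical functor $\Omega(K)\to\mathbf k\mathcal T_I$ is the composite $\Omega(K)\to\Omega B(\mathbf k\mathcal T_I)\to\mathbf k\mathcal T_I$, where $B$ is the bar construction, the first map is induced by the inclusion $e_1\wedge\dots\wedge e_n\mapsto\sum_{\sigma\in S_n}\epsilon(\sigma)(e_{\sigma(1)},\dots,e_{\sigma(n)})$ of $K$ into $B(\mathbf k\mathcal T_I)$, and the second is the counit of the cobar-bar adjunction; explicitly it sends the generator $s^{-1}e$ ($e$ a single edge) to the morphism $e:t\to t/e$ and $s^{-1}(e_1\wedge\dots\wedge e_n)$ to $0$ for $n\ge2$. *)

(* Defs.v *)
From HB Require Import structures.
From mathcomp Require Import perm all_boot all_order all_algebra finmap monalg generic_quotient.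
Set Implicit Arguments. Unset Strict Implicit. Unset Printing Implicit Defensive.

(* Oriented graphs with vertex set V and edge set D, whose edges without
   source are labelled by I: [src d = inr v] means that d leaves the vertex v,
   [src d = inl i] that d has no source and carries the label i, and
   [tgt d = None] that d has no target. *)
Record lgraph (I V D : finType) := LGraph {
  src : {ffun D -> I + V};
  tgt : {ffun D -> option V} }.

Definition lgraph_pair (I V D : finType) (g : lgraph I V D) := (src g, tgt g).
Definition pair_lgraph (I V D : finType) (p : {ffun D -> I + V} * {ffun D -> option V}) :=
  LGraph p.1 p.2.
Lemma lgraph_pairK I V D : cancel (@lgraph_pair I V D) (@pair_lgraph I V D).
Proof. by case. Qed.
HB.instance Definition _ (I V D : finType) :=
  Countable.copy (lgraph I V D) (can_type (@lgraph_pairK I V D)).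

Definition smap (I V W : Type) (f : V -> W) (x : I + V) : I + W :=
  match x with inl i => inl i | inr v => inr (f v) end.

Section Trees.
Variables (I V D : finType) (g : lgraph I V D).

Definition incident : rel (V + D) := fun x y =>
  match x, y with
  | inl v, inr d | inr d, inl v => (src g d == inr v) || (tgt g d == Some v)
  | _, _ => false
  end.

Definition edge_step : rel D := fun d e =>
  [exists v, (tgt g d == Some v) && (src g e == inr v)].

(* Since every vertex has a unique outgoing edge, every cycle of the underlying
   graph is oriented; this is why only oriented cycles are excluded. *)
Definition is_tree : bool :=
  [&& (0 < #|{: V + D}|),
      [forall x, forall y, connect incident x y],
      [forall d, forall e, edge_step d e ==> ~~ connect edge_step e d],
      [forall v, 0 < #|[set d | tgt g d == Some v]|],
      [forall v, #|[set d | src g d == inr v]| == 1] &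
      #|[set d | tgt g d == None]| == 1].

Definition is_labelled : bool := [forall i, #|[set d | src g d == inl i]| == 1].

Definition is_reduced : bool := [forall v, 1 < #|[set d | tgt g d == Some v]|].

Definition is_rtree : bool := [&& is_tree, is_labelled & is_reduced].

Definition internal (d : D) : bool :=
  if src g d is inr _ then isSome (tgt g d) else false.

Definition leaves_above (d : D) : {set I} :=
  [set i | [exists l, (src g l == inl i) && connect edge_step l d]].

(* Adjacency of vertices through an edge of A. *)
Definition adj (A : {set D}) : rel V := fun v w =>
  [exists d in A, ((src g d == inr v) && (tgt g d == Some w)) ||
                  ((src g d == inr w) && (tgt g d == Some v))].

Lemma adj_sym A : symmetric (adj A).
Proof. by move=> v w; apply: eq_existsb => d; rewrite orbC. Qed.

Lemma adj_csym A : connect_sym (adj A).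
Proof. exact/sym_connect_sym/adj_sym. Qed.

Variable A : {set D}.

(* A connected component is represented by its canonical vertex. *)
Definition block := {v : V | fingraph.root (adj A) v == v}.

Lemma block_of_subproof v :
  fingraph.root (adj A) (fingraph.root (adj A) v) == fingraph.root (adj A) v.
Proof. exact/eqP/root_root/adj_csym. Qed.

Definition block_of (v : V) : block := exist (fun v => fingraph.root (adj A) v == v) _ (block_of_subproof v).

Definition contract_vertex (v : V) : 'I_#|{: block}| := enum_rank (block_of v).

Definition kept_edge (d : 'I_#|{: {d : D | d \notin A}}|) : D := val (enum_val d).

(* The edges of A are deleted and the vertices of each connected component of
   the graph formed by A are identified. *)
Definition contract : lgraph I 'I_#|{: block}| 'I_#|{: {d : D | d \notin A}}| :=
  LGraph [ffun d => smap contract_vertex (src g (kept_edge d))]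
         [ffun d => omap contract_vertex (tgt g (kept_edge d))].

End Trees.

Definition iso_lgraph (I V D V' D' : finType) (g : lgraph I V D) (g' : lgraph I V' D') : bool :=
  [exists f : {ffun V -> V'}, exists h : {ffun D -> D'},
    [&& injectiveb f, #|V| == #|V'|, injectiveb h, #|D| == #|D'| &
        [forall d, (src g' (h d) == smap f (src g d)) && (tgt g' (h d) == omap f (tgt g d))]]].

Record contracts (I V D V' D' : finType) (g : lgraph I V D) (A : {set D})
    (g' : lgraph I V' D') (f : V -> V') (h : D' -> D) : Prop := Contracts {
  c_inj : injective h;
  c_codom : forall d, (d \in codom h) = (d \notin A);
  c_src : forall d, src g' d = smap f (src g (h d));
  c_tgt : forall d, tgt g' d = omap f (tgt g (h d));
  c_surj : forall v', exists v, f v = v';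
  c_fib : forall v w, (f v == f w) = connect (adj g A) v w }.

Lemma smap_comp (I U V W : Type) (f : V -> W) (k : U -> V) (x : I + U) :
  smap f (smap k x) = smap (fun u => f (k u)) x.
Proof. by case: x. Qed.

Lemma eq_smap (I V W : Type) (f k : V -> W) (x : I + V) : f =1 k -> smap f x = smap k x.
Proof. by case: x => //= v ->. Qed.

Section ContractsTheory.
Variables (I : finType).

Lemma contract_contracts V D (g : lgraph I V D) A :
  contracts g A (contract g A) (@contract_vertex _ _ _ g A) (@kept_edge D A).
Proof.
split.
- by move=> d e /val_inj/enum_val_inj.
- move=> d; apply/codomP/idP => [[e ->]|dA]; first exact: valP (enum_val e).
  by exists (enum_rank (exist (fun d => d \notin A) d dA)); rewrite /kept_edge enum_rankK.
- by move=> d; rewrite ffunE.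
- by move=> d; rewrite ffunE.
- move=> v'; exists (val (enum_val v')); apply: (canLR (@enum_valK _)).
  by apply: val_inj => /=; apply/eqP; exact: (valP (enum_val v')).
- move=> v w; rewrite (inj_eq (@enum_rank_inj _)) -val_eqE /=.
  exact/root_connect/adj_csym.
Qed.

Lemma adj0 V D (g : lgraph I V D) : adj g set0 =2 (fun _ _ => false).
Proof. by move=> v w; apply/existsP => -[d]; rewrite inE. Qed.

Lemma connect_adj0 V D (g : lgraph I V D) v w : connect (adj g set0) v w = (v == w).
Proof.
rewrite (eq_connect (adj0 g)); apply/idP/eqP => [|->]; last exact: connect0.
by case/connectP => -[|x p] //= _ ->.
Qed.

Lemma smap_id (V : finType) (x : I + V) : smap id x = x.
Proof. by case: x. Qed.

Lemma contracts_refl V D (g : lgraph I V D) : contracts g set0 g id id.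
Proof.
split=> //; first by move=> d; rewrite inE codom_f.
- by move=> d; rewrite smap_id.
- by move=> d; rewrite omap_id.
- by move=> v; exists v.
- by move=> v w; rewrite connect_adj0.
Qed.

Lemma isoP V D V' D' (g : lgraph I V D) (g' : lgraph I V' D') :
  iso_lgraph g g' <-> exists f h, contracts g set0 g' f h.
Proof.
split.
  case/existsP => f /existsP[h] /and5P[/injectiveP fi /eqP cV /injectiveP hi /eqP cD].
  move/forallP => H.
  have [h' hK h'K] := inj_card_bij hi (eq_leq (esym cD)).
  have [f' fK f'K] := inj_card_bij fi (eq_leq (esym cV)).
  exists f, h'; split.
  - exact: can_inj h'K.
  - by move=> d; rewrite inE -[d]hK codom_f.
  - by move=> d; case/andP: (H (h' d)); rewrite h'K => /eqP.
  - by move=> d; case/andP: (H (h' d)); rewrite h'K => _ /eqP.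
  - by move=> v; exists (f' v).
  - by move=> v w; rewrite connect_adj0 inj_eq.
case=> f [h [hi hc hs ht fs ff]].
have fi : injective f by move=> v w /eqP; rewrite ff connect_adj0 => /eqP.
have hsurj d : d \in codom h by rewrite hc inE.
pose h' d := iinv (hsurj d).
have h'K : cancel h' h by move=> d; rewrite f_iinv.
have hK : cancel h h' by move=> d; apply: hi; rewrite h'K.
have cD : #|D'| = #|D| by apply: bij_eq_card; exists h'.
have cV : #|V| = #|V'|.
  apply/eqP; rewrite eqn_leq (leq_card f fi) /=.
  apply: (@leq_trans #|codom f|); last exact: leq_image_card.
  by apply/subset_leq_card/subsetP => v' _; have [v <-] := fs v'; rewrite codom_f.
apply/existsP; exists (finfun f); apply/existsP; exists (finfun h').
apply/and5P; split.
- by apply/injectiveP => v w; rewrite !ffunE => /fi.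
- exact/eqP.
- by apply/injectiveP => v w; rewrite !ffunE => /(can_inj h'K).
- by rewrite cD.
- apply/forallP => d; rewrite !ffunE hs ht h'K; apply/andP; split; apply/eqP.
    by apply: eq_smap => v; rewrite ffunE.
  by case: (tgt g d) => //= v; rewrite ffunE.
Qed.

Lemma contracts_uniq V D V1 D1 V2 D2 (g : lgraph I V D) A
    (g1 : lgraph I V1 D1) (g2 : lgraph I V2 D2) f1 h1 f2 h2 :
  contracts g A g1 f1 h1 -> contracts g A g2 f2 h2 ->
  exists f h, contracts g1 set0 g2 f h.
Proof.
move=> [i1 c1 s1 t1 r1 b1] [i2 c2 s2 t2 r2 b2].
have sec v1 : exists v, f1 v == v1 by have [v <-] := r1 v1; exists v.
pose p v1 := xchoose (sec v1).
have pK v1 : f1 (p v1) = v1 by apply/eqP; exact: (xchooseP (sec v1)).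
have fp v : f2 (p (f1 v)) = f2 v by apply/eqP; rewrite b2 -b1 pK.
have hsec d : h2 d \in codom h1 by rewrite c1 -c2 codom_f.
pose h d := iinv (hsec d).
have hE d : h1 (h d) = h2 d by rewrite f_iinv.
exists (fun v1 => f2 (p v1)), h; split.
- by move=> d e /(congr1 h1); rewrite !hE => /i2.
- move=> d; rewrite inE; apply/codomP.
  have /codomP[e E] : h1 d \in codom h2 by rewrite c2 -c1 codom_f.
  by exists e; apply: i1; rewrite hE.
- by move=> d; rewrite s2 s1 hE smap_comp; apply/esym/eq_smap.
- by move=> d; rewrite t2 t1 hE; case: (tgt g _) => //= v; rewrite fp.
- by move=> v2; have [v <-] := r2 v2; exists (f1 v); rewrite fp.
- by move=> v w; rewrite connect_adj0 b2 -b1 !pK.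
Qed.

Lemma contracts_comp V D V1 D1 V2 D2 (g : lgraph I V D) A
    (g1 : lgraph I V1 D1) B (g2 : lgraph I V2 D2) f1 h1 f2 h2 :
  contracts g A g1 f1 h1 -> contracts g1 B g2 f2 h2 ->
  contracts g (A :|: h1 @: B) g2 (fun v => f2 (f1 v)) (fun d => h1 (h2 d)).
Proof.
move=> [i1 c1 s1 t1 r1 b1] [i2 c2 s2 t2 r2 b2].
split.
- by move=> d e /i1/i2.
- move=> d; rewrite inE negb_or -c1; apply/codomP/andP => [[e ->]|[/codomP[e ->] N]].
    split; first exact: codom_f.
    by rewrite (mem_imset _ _ i1) -c2 codom_f.
  rewrite (mem_imset _ _ i1) -c2 in N.
  by case/codomP: N => d' ->; exists d'.
- by move=> d; rewrite s2 s1 smap_comp.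
- by move=> d; rewrite t2 t1; case: (tgt g _).
- by move=> v2; have [v1 <-] := r2 v2; have [v <-] := r1 v1; exists v.
- have subA v w : connect (adj g A) v w -> connect (adj g (A :|: h1 @: B)) v w.
    apply: connect_sub => x y /existsP[d /andP[dA H]]; apply: connect1.
    by apply/existsP; exists d; rewrite inE dA.
  have step1 d v1 w1 v w : d \in B -> src g1 d = inr v1 -> tgt g1 d = Some w1 ->
      f1 v = v1 -> f1 w = w1 -> connect (adj g (A :|: h1 @: B)) v w.
    move=> dB; rewrite s1 t1; case Es: (src g _) => [//|x] [fx].
    case Et: (tgt g _) => [y|//] [fy] fv fw.
    apply: (@connect_trans _ _ x); first by apply: subA; rewrite -b1 fv fx.
    apply: (@connect_trans _ _ y); last by apply: subA; rewrite -b1 fw fy.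
    apply/connect1/existsP; exists (h1 d).
    by rewrite inE (imset_f h1 dB) orbT Es Et !eqxx.
  move=> v w; rewrite b2; apply/idP/idP.
    case/connectP => p; move E: (f1 v) => v1.
    elim: p v v1 E => [|y1 p IHp] v v1 E /=.
      by move=> _ fw; apply: subA; rewrite -b1 E fw.
    case/andP => /existsP[d /andP[dB st]] py wl.
    have [y Ey] := r1 y1.
    apply: connect_trans (IHp _ _ Ey py wl).
    case/orP: st => /andP[/eqP Es /eqP Et]; first exact: step1 dB Es Et E Ey.
    by rewrite adj_csym; exact: step1 dB Es Et Ey E.
  have sym := adj_csym g1 B.
  move=> H; suff: closed (adj g (A :|: h1 @: B)) [pred x | connect (adj g1 B) (f1 v) (f1 x)].
    by move=> cl; move: (closed_connect cl H); rewrite !inE connect0 => <-.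
  apply: intro_closed; first exact: adj_csym.
  move=> x y /existsP[d /andP[]]; rewrite !inE => /orP[dA|/imsetP[d1 dB ->]] st vx.
    have /eqP <- // : f1 x == f1 y.
    by rewrite b1; apply/connect1/existsP; exists d; rewrite dA.
  apply: connect_trans vx (connect1 _); apply/existsP; exists d1; rewrite dB /= s1 t1.
  by case/orP: st => /andP[/eqP-> /eqP->]; rewrite /= !eqxx ?orbT.
Qed.

Section Shape.
Variables (V D V' D' : finType) (g : lgraph I V D) (A : {set D}) (g' : lgraph I V' D').
Variables (f : V -> V') (h : D' -> D).
Hypotheses (gT : is_rtree g) (Ai : {in A, forall d, internal g d}).
Hypothesis C : contracts g A g' f h.

Let fib v w : f v = f w <-> connect (adj g A) v w.
Proof. by rewrite -(c_fib C); split=> [->|/eqP]. Qed.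

Lemma rtree_src_uniq d e v : src g d = inr v -> src g e = inr v -> d = e.
Proof.
move=> sd se; case/and3P: gT => /and5P[_ _ _ _ /andP[/forallP/(_ v)/cards1P[x H] _]] _ _.
by move/setP: H => H; move: (H d) (H e); rewrite !inE sd se eqxx => /esym/eqP-> /esym/eqP->.
Qed.


Let dstep : rel V := fun v w => [exists d in A, (src g d == inr v) && (tgt g d == Some w)].

Lemma connect_dstep v w e : connect (adj g A) v w -> src g e = inr w -> e \notin A ->
  connect dstep v w.
Proof.
move=> vw se eA.
suff cl : closed (adj g A) [pred x | connect dstep x w].
  by move: (closed_connect cl vw); rewrite !inE connect0.
apply: intro_closed; first exact: adj_csym.
have fwd x y b : b \in A -> src g b = inr x -> tgt g b = Some y ->
    connect dstep x w -> connect dstep y w.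
  move=> bA sb tb /connectP[[|z p] /=].
    by move=> _ E; subst x; rewrite (rtree_src_uniq sb se) (negbTE eA) in bA.
  case/andP => /existsP[a /and3P[aA /eqP sa /eqP ta]] zp wl.
  move: ta; rewrite (rtree_src_uniq sa sb) tb => -[->].
  by apply/connectP; exists p.
move=> x y /existsP[b /andP[bA /orP[] /andP[/eqP sb /eqP tb]]]; rewrite !inE.
  exact: fwd bA sb tb.
move=> xw; apply: connect_trans xw; apply/connect1/existsP; exists b.
by rewrite bA sb tb !eqxx.
Qed.

Lemma bottom_uniq v w d e : connect (adj g A) v w -> src g d = inr v -> d \notin A ->
  src g e = inr w -> e \notin A -> d = e.
Proof.
move=> vw sd dA se eA; have /connectP[[|z p] /=] := connect_dstep vw se eA.
  by move=> _ E; subst w; exact: rtree_src_uniq sd se.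
case/andP => /existsP[a /and3P[aA /eqP sa _]] _ _.
by rewrite (rtree_src_uniq sd sa) aA in dA.
Qed.

Lemma dstep_edge v w d e : connect dstep v w -> tgt g d = Some v -> src g e = inr w ->
  exists2 x, edge_step g d x & connect (edge_step g) x e.
Proof.
case/connectP => p; elim: p v d => [|z p IHp] v d /=.
  move=> _ -> td se; exists e => //.
  by apply/existsP; exists v; rewrite td se !eqxx.
case/andP => /existsP[a /and3P[aA /eqP sa /eqP ta]] zp wl td se.
have [x ax xe] := IHp z a zp wl ta se.
exists a; last exact: connect_trans (connect1 ax) xe.
by apply/existsP; exists v; rewrite td sa !eqxx.
Qed.

Lemma kept d' : h d' \notin A.
Proof. by rewrite -(c_codom C) codom_f. Qed.

Lemma keptP d : d \notin A -> exists d', h d' = d.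
Proof. by rewrite -(c_codom C) => /codomP[d' ->]; exists d'. Qed.

Lemma edge_step_lift d e : edge_step g' d e ->
  exists2 x, edge_step g (h d) x & connect (edge_step g) x (h e).
Proof.
case/existsP => v' /andP[]; rewrite (c_tgt C) (c_src C).
case Et: (tgt g (h d)) => [v|//] /eqP[fv].
case Es: (src g (h e)) => [//|w] /eqP[fw].
apply: (dstep_edge (v := v) (w := w)) => //.
by apply: connect_dstep Es (kept e); apply/fib; rewrite fv fw.
Qed.

Lemma connect_edge_lift d e : connect (edge_step g') d e -> connect (edge_step g) (h d) (h e).
Proof.
case/connectP => p; elim: p d => [|x p IHp] d /=; first by move=> _ ->; exact: connect0.
case/andP => /edge_step_lift[y dy yx] xp el.
exact: connect_trans (connect1 dy) (connect_trans yx (IHp _ xp el)).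
Qed.

Lemma connect_edge d e : connect (edge_step g') d e = connect (edge_step g) (h d) (h e).
Proof.
apply/idP/idP; first exact: connect_edge_lift.
pose Q x := exists2 d'', connect (edge_step g') d d'' &
  h d'' = x \/ x \in A /\ omap f (tgt g (h d'')) = omap f (tgt g x).
suff QP x p : Q x -> path (edge_step g) x p -> Q (last x p).
  case/connectP => p pp El; have: Q (h d) by exists d; [exact: connect0 | left].
  move/QP => /(_ _ pp); rewrite -El => -[d'' dd [/(c_inj C) <- //|[eA]]].
  by rewrite (negbTE (kept e)) in eA.
elim: p x => [|y p IHp] x //= Qx /andP[xy yp]; apply: (IHp y) => //.
case/existsP: xy => v /andP[/eqP tx /eqP sy].
have [d'' dd H] := Qx.
have Et : omap f (tgt g (h d'')) = Some (f v) by case: H => [->|[_ ->]]; rewrite tx.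
have [yA|yA] := boolP (y \in A); last first.
  have [d2 E2] := keptP yA; exists d2; last by left.
  apply: connect_trans dd (connect1 _); apply/existsP; exists (f v).
  by rewrite (c_tgt C) Et (c_src C) E2 sy !eqxx.
exists d'' => //; right; split => //; rewrite Et.
have := Ai yA; rewrite /internal sy; case ty: (tgt g y) => [w|//] _ /=.
congr Some; apply/fib/connect1/existsP; exists y.
by rewrite yA sy ty !eqxx.
Qed.

Lemma edge_acyclic d e : edge_step g d e -> connect (edge_step g) e d -> False.
Proof.
case/and3P: gT => /and5P[_ _ /forallP/(_ d)/forallP/(_ e)/implyP H _ _] _ _.
by move=> /H/negbTE->.
Qed.

Let ht d := #|[set x | connect (edge_step g) d x]|.

Let ht_step d e : edge_step g d e -> ht e < ht d.
Proof.
move=> de; apply/proper_card/properP; split.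
  by apply/subsetP => x; rewrite !inE; exact/connect_trans/connect1.
exists d; rewrite !inE ?connect0 //; apply/negP.
exact: edge_acyclic de.
Qed.

Lemma out_edge v : exists d, src g d = inr v.
Proof.
case/and3P: gT => /and5P[_ _ _ _ /andP[/forallP/(_ v)/cards1P[x H] _]] _ _.
by exists x; apply/eqP; move/setP/(_ x): H; rewrite !inE eqxx.
Qed.

Lemma in_edges v : 1 < #|[set d | tgt g d == Some v]|.
Proof. by case/and3P: gT => _ _ /forallP. Qed.

Lemma leaf_edge i : exists d, forall e, (src g e == inl i) = (e == d).
Proof.
case/and3P: gT => _ /forallP/(_ i)/cards1P[x H] _.
by exists x => e; move/setP/(_ e): H; rewrite !inE.
Qed.

Lemma root_edge : exists d, forall e, (tgt g e == None) = (e == d).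
Proof.
case/and3P: gT => /and5P[_ _ _ _ /andP[_ /cards1P[x H]]] _ _.
by exists x => e; move/setP/(_ e): H; rewrite !inE.
Qed.

Lemma nonint_src d i : src g d = inl i -> d \notin A.
Proof. by move=> sd; apply/negP => /Ai; rewrite /internal sd. Qed.

Lemma nonint_tgt d : tgt g d = None -> d \notin A.
Proof. by move=> td; apply/negP => /Ai; rewrite /internal td; case: (src g d). Qed.

Lemma bottomP v' : exists2 d, d \notin A & exists2 v, src g d = inr v & f v = v'.
Proof.
have [v0 fv0] := c_surj C v'; have [d0 sd0] := out_edge v0.
have [n] := ubnP (ht d0); elim: n v0 d0 fv0 sd0 => // n IHn v d fv sd.
rewrite ltnS => hd; have [dA|dA] := boolP (d \in A); last by exists d => //; exists v.
have := Ai dA; rewrite /internal sd; case td: (tgt g d) => [w|//] _.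
have [e se] := out_edge w.
apply: (IHn w e) => //.
  by rewrite -fv; apply/esym/fib/connect1/existsP; exists d; rewrite dA sd td !eqxx.
apply: leq_trans (ht_step _) hd; apply/existsP; exists w.
by rewrite td se !eqxx.
Qed.

Lemma topP v' : exists2 v, f v = v' & forall d, tgt g d = Some v -> d \notin A.
Proof.
have [v0 fv0] := c_surj C v'; have [d0 sd0] := out_edge v0.
have [n] := ubnP (#|D| - ht d0); elim: n v0 d0 fv0 sd0 => // n IHn v d fv sd.
rewrite ltnS => hd.
have [/forallP H|/forallPn[e]] := boolP [forall e, (tgt g e == Some v) ==> (e \notin A)].
  by exists v => // e te; move: (H e); rewrite te eqxx.
rewrite negb_imply negbK => /andP[/eqP te eA].
have := Ai eA; rewrite /internal; case se: (src g e) => [//|w] _.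
apply: (IHn w e) => //.
  by rewrite -fv; apply/fib/connect1/existsP; exists e; rewrite eA se te !eqxx.
have lt : ht d < ht e.
  by apply: ht_step; apply/existsP; exists v; rewrite te sd !eqxx.
apply: leq_trans hd; apply: ltn_sub2l => //.
by apply: leq_trans lt _; exact: max_card.
Qed.

Lemma contracts_rtree : is_rtree g'.
Proof.
have [r rP] := root_edge.
have rA : r \notin A by apply: nonint_tgt; apply/eqP; rewrite rP.
have [r' hr'] := keptP rA.
have two v' : 1 < #|[set d | tgt g' d == Some v']|.
  have [v fv vA] := topP v'.
  apply: leq_trans (in_edges v) _.
  have sub : [set d | tgt g d == Some v] \subset h @: [set d | tgt g' d == Some v'].
    apply/subsetP => d; rewrite inE => /eqP td.
    have [d' E] := keptP (vA d td); rewrite -E; apply: imset_f.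
    by rewrite inE (c_tgt C) E td /= fv.
  by apply: leq_trans (subset_leq_card sub) _; exact: leq_imset_card.
apply/and3P; split; last by apply/forallP.
- apply/and5P; split.
  + by apply/card_gt0P; exists (inr r').
  + pose rel_ph (x : V + D) (y : V' + D') :=
      match x with
      | inl v => y = inl (f v)
      | inr d => (exists2 d', h d' = d & y = inr d') \/
                 (d \in A /\ exists2 v, src g d = inr v & y = inl (f v))
      end.
    have tot x : exists y, rel_ph x y.
      case: x => [v|d]; first by exists (inl (f v)).
      have [dA|/keptP[d' E]] := boolP (d \in A); last by exists (inr d'); left; exists d'.
      have := Ai dA; rewrite /internal; case sd: (src g d) => [//|v] _.
      by exists (inl (f v)); right; split => //; exists v.
    have fAd v w d : d \in A -> src g d = inr v -> tgt g d = Some w -> f v = f w.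
      by move=> dA sd td; apply/fib/connect1/existsP; exists d; rewrite dA sd td !eqxx.
    have isym : symmetric (incident g') by case=> [?|?] [?|?].
    have vd v d y : (src g d == inr v) || (tgt g d == Some v) -> rel_ph (inr d) y ->
        connect (incident g') (inl (f v)) y.
      move=> inc [[d' E ->]|[dA [w sd ->]]].
        apply: connect1; rewrite /= (c_src C) (c_tgt C) E.
        by case/orP: inc => /eqP-> /=; rewrite eqxx ?orbT.
      suff -> : f v = f w by exact: connect0.
      case/orP: inc => /eqP H; first by move: H; rewrite sd => -[->].
      by apply/esym; exact: fAd sd H.
    have st x x1 y y1 : incident g x x1 -> rel_ph x y -> rel_ph x1 y1 ->
        connect (incident g') y y1.
      case: x x1 => [v|d] [w|e] //= inc; first by move=> ->; exact: vd.
      move=> H ->; rewrite (sym_connect_sym isym); exact: vd inc H.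
    have det x y y1 : rel_ph x y -> rel_ph x y1 -> y = y1.
      case: x => [v -> -> //|d] [[d1 E1 ->]|[dA [v sv ->]]] [[d2 E2 ->]|[dA2 [w sw ->]]].
      - by rewrite (c_inj C (etrans E1 (esym E2))).
      - by move: (kept d1); rewrite E1 dA2.
      - by move: (kept d2); rewrite E2 dA.
      - by move: sw; rewrite sv => -[->].
    have cn x p y y1 : path (incident g) x p -> rel_ph x y -> rel_ph (last x p) y1 ->
        connect (incident g') y y1.
      elim: p x y => [|z p IHp] x y /=; first by move=> _ /det H /H ->; exact: connect0.
      case/andP => xz zp xy l1; have [y2 zy2] := tot z.
      exact: connect_trans (st _ _ _ _ xz xy zy2) (IHp _ _ zp zy2 l1).
    have surj y : exists x, rel_ph x y.
      case: y => [v'|d']; last by exists (inr (h d')); left; exists d'.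
      by have [v <-] := c_surj C v'; exists (inl v).
    apply/forallP => y; apply/forallP => y1.
    have [x xy] := surj y; have [x1 xy1] := surj y1.
    have /connectP[p pp El] : connect (incident g) x x1.
      by case/and3P: gT => /and5P[_ /forallP/(_ x)/forallP/(_ x1)].
    by apply: (cn x p) => //; rewrite -El.
  + apply/forallP => d; apply/forallP => e; apply/implyP => de; apply/negP.
    rewrite connect_edge => ed; have [x dx xe] := edge_step_lift de.
    exact: edge_acyclic dx (connect_trans xe ed).
  + by apply/forallP => v; exact: ltnW (two v).
  + apply/andP; split.
      apply/forallP => v'; have [d dA [v sd fv]] := bottomP v'.
      have [d' E] := keptP dA; apply/cards1P; exists d'; apply/setP => e.
      rewrite !inE (c_src C); apply/eqP/eqP => [|->]; last by rewrite E sd /= fv.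
      case se: (src g (h e)) => [//|w] [fw]; apply: (c_inj C); rewrite E.
      by apply: bottom_uniq se (kept e) sd dA; apply/fib; rewrite fw fv.
    apply/cards1P; exists r'; apply/setP => e; rewrite !inE (c_tgt C).
    rewrite -(inj_eq (c_inj C)) hr' -rP.
    by case: (tgt g (h e)).
- apply/forallP => i; have [l lP] := leaf_edge i.
  have [l' E] : exists l', h l' = l.
    by apply: keptP; apply: (@nonint_src _ i); apply/eqP; rewrite lP.
  apply/cards1P; exists l'; apply/setP => e; rewrite !inE (c_src C).
  rewrite -(inj_eq (c_inj C)) E -lP.
  by case: (src g (h e)).
Qed.

Lemma contracts_above d : leaves_above g' d = leaves_above g (h d).
Proof.
apply/setP => i; rewrite !inE; apply/existsP/existsP => -[l /andP[/eqP sl ld]].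
  exists (h l); rewrite -connect_edge ld andbT.
  by move: sl; rewrite (c_src C); case: (src g (h l)) => //= j [->].
have [l' E] := keptP (nonint_src sl); exists l'.
by rewrite (c_src C) connect_edge E sl ld eqxx.
Qed.

Lemma contracts_internal d : internal g' d = internal g (h d).
Proof.
rewrite /internal (c_src C) (c_tgt C).
by case: (src g (h d)) => //= _; case: (tgt g (h d)).
Qed.
End Shape.

(* In a reduced tree an edge is determined by the set of leaves above it. *)
Lemma leaves_above_inj V D (g : lgraph I V D) : is_rtree g -> injective (leaves_above g).
Proof.
move=> gT.
have fc d x y : connect (edge_step g) d x -> connect (edge_step g) d y ->
    connect (edge_step g) x y \/ connect (edge_step g) y x.
  case/connectP => p; elim: p d => [|z p IHp] d /=; first by move=> _ ->; left.
  case/andP => /existsP[v /andP[/eqP td /eqP sz]] zp xl /connectP[[|z' q] /=].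
    move=> _ ->; right; apply/connectP; exists (z :: p) => //=; rewrite zp andbT.
    by apply/existsP; exists v; rewrite td sz !eqxx.
  case/andP => /existsP[v' /andP[/eqP td' /eqP sz']] zq yl.
  move: td' sz'; rewrite td => -[<-] sz'; have Ez := rtree_src_uniq gT sz' sz; subst z'.
  by apply: (IHp z) => //; apply/connectP; exists q.
have ne d : exists2 l, connect (edge_step g) l d & exists i, src g l = inl i.
  pose up x := #|[set y | connect (edge_step g) y x]|.
  have [n] := ubnP (up d); elim: n d => // n IHn d; rewrite ltnS => hn.
  case sd: (src g d) => [i|v]; first by exists d => //; exists i.
  have /card_gt0P[e] := ltnW (in_edges gT v); rewrite inE => /eqP te.
  have ed : edge_step g e d by apply/existsP; exists v; rewrite te sd !eqxx.
  have [|l le il] := IHn e; last first.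
    by exists l => //; exact: connect_trans le (connect1 ed).
  apply: leq_trans hn; apply/proper_card/properP; split.
    by apply/subsetP => y; rewrite !inE => ye; exact: connect_trans ye (connect1 ed).
  exists d; rewrite !inE ?connect0 //; apply/negP.
  exact: edge_acyclic gT _ _ ed.
have lt d e : connect (edge_step g) d e -> leaves_above g d = leaves_above g e -> d = e.
  case/connectP => -[|z p] //= /andP[dz zp] el E.
  case/existsP: (dz) => v /andP[/eqP td /eqP sz].
  have /card_gt1P[a [b [ta tb nab]]] := in_edges gT v.
  have {a b ta tb nab} [c [tc cd]] : exists c, tgt g c = Some v /\ c != d.
    rewrite !inE in ta tb; have [Ea|na] := eqVneq a d; last by exists a; rewrite (eqP ta).
    by exists b; rewrite (eqP tb) -Ea eq_sym.
  have cz : edge_step g c z by apply/existsP; exists v; rewrite tc sz !eqxx.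
  have ze : connect (edge_step g) z e by apply/connectP; exists p.
  have [l lc [i sl]] := ne c.
  have: i \in leaves_above g e.
    rewrite inE; apply/existsP; exists l; rewrite sl eqxx.
    exact: connect_trans lc (connect_trans (connect1 cz) ze).
  rewrite -E inE => /existsP[l' /andP[sl' ld]].
  have El : l' = l.
    by have [x xP] := leaf_edge gT i; move: (xP l) (xP l'); rewrite sl' sl eqxx => /esym/eqP-> /esym/eqP->.
  rewrite {}El in ld.
  have strict x y : tgt g x = Some v -> tgt g y = Some v -> x != y ->
      connect (edge_step g) x y -> False.
    move=> tx ty nxy /connectP[[|w q] /=]; first by move=> _ Ey; rewrite Ey eqxx in nxy.
    case/andP => /existsP[v' /andP[]]; rewrite tx => /eqP[<-] /eqP sw wq yl.
    rewrite (rtree_src_uniq gT sw sz) in wq yl.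
    apply: (edge_acyclic gT (d := y) (e := z)).
      by apply/existsP; exists v; rewrite ty sz !eqxx.
    by apply/connectP; exists q.
  case: (fc _ _ _ lc ld) => H; first by case: (strict _ _ tc td cd H).
  by rewrite eq_sym in cd; case: (strict _ _ td tc cd H).
move=> d e E; have [l ld [i sl]] := ne d.
have: i \in leaves_above g d by rewrite inE; apply/existsP; exists l; rewrite sl eqxx.
rewrite E inE => /existsP[l' /andP[sl' le]].
have El : l' = l.
  by have [x xP] := leaf_edge gT i; move: (xP l) (xP l'); rewrite sl' sl eqxx => /esym/eqP-> /esym/eqP->.
rewrite {}El in le.
by case: (fc _ _ _ ld le) => /lt H; [exact: H | rewrite H].
Qed.
End ContractsTheory.

Section Objects.
Variable I : finType.

(* Every finite graph is isomorphic to one whose vertices and edges are initial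
   segments of nat, hence every isomorphism class of trees is represented. *)
Definition coded_graph := {n : nat * nat & lgraph I 'I_n.1 'I_n.2}.

Definition rtree := {c : coded_graph | is_rtree (tagged c)}.

Definition graph_of (t : rtree) : lgraph I 'I_(tag (val t)).1 'I_(tag (val t)).2 :=
  tagged (val t).

Definition mk_rtree n m (g : lgraph I 'I_n 'I_m) (gT : is_rtree g) : rtree :=
  exist (fun c : coded_graph => is_rtree (tagged c))
    (existT (fun n : nat * nat => lgraph I 'I_n.1 'I_n.2) (n, m) g) gT.

Definition iso_rtree : rel rtree := fun t s => iso_lgraph (graph_of t) (graph_of s).

Lemma iso_rtree_refl : reflexive iso_rtree.
Proof. by move=> t; apply/isoP; exists id, id; exact: contracts_refl. Qed.

Lemma iso_rtree_sym : symmetric iso_rtree.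
Proof.
suff sub t s : iso_rtree t s -> iso_rtree s t by move=> t s; apply/idP/idP; exact: sub.
case/isoP => f [h C]; apply/isoP; exact: contracts_uniq C (contracts_refl _).
Qed.

Lemma iso_rtree_trans : transitive iso_rtree.
Proof.
move=> s t u /isoP[f [h C]] /isoP[f' [h' C']]; apply/isoP.
exists (fun v => f' (f v)), (fun d => h (h' d)).
by have := contracts_comp C C'; rewrite imset0 setU0.
Qed.

Canonical iso_rtree_equiv := EquivRel iso_rtree iso_rtree_refl iso_rtree_sym iso_rtree_trans.

Definition tree_class := {eq_quot iso_rtree}%qT.
HB.instance Definition _ := Choice.on tree_class.
HB.instance Definition _ := EqQuotient.on tree_class.

Definition edge_names (t : rtree) : {set {set I}} :=
  [set leaves_above (graph_of t) d | d in [pred d | internal (graph_of t) d]].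

(* The set of internal edges of t, each edge being named by the set of labels of
   the leaves above it. This name is invariant under isomorphism and under
   contraction, and by leaves_above_inj it determines the edge. *)
Definition edges (t : tree_class) : {set {set I}} := edge_names (repr t).

Definition named_edges (t : rtree) (E : {set {set I}}) :=
  [set d | internal (graph_of t) d & leaves_above (graph_of t) d \in E].

Lemma named_edges_internal t E : {in named_edges t E, forall d, internal (graph_of t) d}.
Proof. by move=> d; rewrite inE => /andP[]. Qed.

Lemma contract_rtree_subproof t E : is_rtree (contract (graph_of t) (named_edges t E)).
Proof.
exact: contracts_rtree (valP t) (@named_edges_internal t E) (contract_contracts _ _).
Qed.

Definition contract_rtree (t : rtree) (E : {set {set I}}) : rtree :=
  mk_rtree (contract_rtree_subproof t E).

Definition contract_class (t : tree_class) (E : {set {set I}}) : tree_class :=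
  \pi_tree_class%qT (contract_rtree (repr t) E).

Lemma contracts_names t s E f h :
  contracts (graph_of t) (named_edges t E) (graph_of s) f h ->
  edge_names s = edge_names t :\: E.
Proof.
move=> C; have Ab := contracts_above (valP t) (@named_edges_internal t E) C.
apply/setP => X; rewrite inE; apply/imsetP/andP.
  case=> d; rewrite inE (contracts_internal C) => di ->.
  rewrite Ab; split; last by apply/imsetP; exists (h d).
  by apply/negP => HE; have := kept C d; rewrite inE di HE.
case=> XE /imsetP[d]; rewrite inE => di EX.
have dA : d \notin named_edges t E by rewrite inE di -EX (negbTE XE).
have [d' Ed] := keptP C dA; exists d'; last by rewrite Ab Ed.
by rewrite inE (contracts_internal C) Ed.
Qed.

Lemma named_edges0 t : named_edges t set0 = set0.
Proof. by apply/setP => d; rewrite !inE andbF. Qed.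

Lemma repr_pi_contracts t :
  exists f h, contracts (graph_of t) set0 (graph_of (repr (\pi_tree_class%qT t))) f h.
Proof.
have H : iso_rtree (repr (\pi_tree_class%qT t)) t by apply/eqmodP; exact: reprK.
by apply/isoP; rewrite -[iso_lgraph _ _]/(iso_rtree _ _) iso_rtree_sym.
Qed.

Lemma repr_contract_class t E : exists f h,
  contracts (graph_of (repr t)) (named_edges (repr t) E) (graph_of (repr (contract_class t E))) f h.
Proof.
have [f [h C]] := repr_pi_contracts (contract_rtree (repr t) E).
have := contracts_comp (contract_contracts (graph_of (repr t)) (named_edges (repr t) E)) C.
by rewrite imset0 setU0 => C'; do 2 eexists; exact: C'.
Qed.

Lemma edges_contract t E : edges (contract_class t E) = edges t :\: E.
Proof. by have [f [h /contracts_names]] := repr_contract_class t E. Qed.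

Lemma eq_tree_class (t s : tree_class) f h :
  contracts (graph_of (repr t)) set0 (graph_of (repr s)) f h -> t = s.
Proof.
by move=> C; rewrite -[t]reprK -[s]reprK; apply/eqmodP/isoP; exists f, h.
Qed.

Lemma contract0 t : contract_class t set0 = t.
Proof.
have [f [h]] := repr_contract_class t set0; rewrite named_edges0.
by move/eq_tree_class.
Qed.

Lemma contractU t E F : contract_class (contract_class t E) F = contract_class t (E :|: F).
Proof.
have [f1 [h1 C1]] := repr_contract_class t E.
have [f2 [h2 C2]] := repr_contract_class (contract_class t E) F.
have [f3 [h3 C3]] := repr_contract_class t (E :|: F).
have := contracts_comp C1 C2.
suff -> : named_edges (repr t) E :|: [set h1 x | x in named_edges (repr (contract_class t E)) F] =
    named_edges (repr t) (E :|: F).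
  by move=> C; have [f [h /eq_tree_class]] := contracts_uniq C C3.
have Ab := contracts_above (valP (repr t)) (@named_edges_internal (repr t) E) C1.
apply/setP => d; rewrite !inE; apply/orP/idP.
  case=> [/andP[-> ->] //|/imsetP[d']]; rewrite inE (contracts_internal C1) Ab.
  by case/andP => di dF ->; rewrite di dF orbT.
case/andP => di; rewrite di /=.
have [dE|dE] := boolP (leaves_above _ d \in E); [by left | move=> /= dF; right].
have dA : d \notin named_edges (repr t) E by rewrite inE di (negbTE dE).
have [d' Ed] := keptP C1 dA; apply/imsetP; exists d' => //.
by rewrite inE (contracts_internal C1) Ab Ed di dF.
Qed.

(* The set of E contained in the internal edges of t with s = t/E. By
   edges_contract it has at most one element. *)
Definition mor (t s : tree_class) :=
  {E : {set {set I}} | (E \subset edges t) && (contract_class t E == s)}.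

Lemma mor_unique t s (E F : mor t s) : E = F.
Proof.
apply: val_inj; have /andP[Et /eqP Es] := valP E; have /andP[Ft /eqP Fs] := valP F.
have: edges t :\: val E = edges t :\: val F by rewrite -!edges_contract Es Fs.
move/(congr1 (setD (edges t))); rewrite !setDDr !setDv !set0U.
by rewrite (setIidPr Et) (setIidPr Ft).
Qed.

Lemma mor_id_subproof t : (set0 \subset edges t) && (contract_class t set0 == t).
Proof. by rewrite sub0set contract0 eqxx. Qed.

Definition mor_id (t : tree_class) : mor t t := Sub set0 (mor_id_subproof t).

Lemma mor_comp_subproof t x s (F : mor x s) (E : mor t x) :
  (val E :|: val F \subset edges t) && (contract_class t (val E :|: val F) == s).
Proof.
have /andP[Et /eqP Ex] := valP E; have /andP[Fx /eqP Fs] := valP F.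
rewrite -contractU Ex Fs eqxx andbT subUset Et /=.
by apply: subset_trans Fx _; rewrite -Ex edges_contract subsetDl.
Qed.

Definition mor_comp (t x s : tree_class) (F : mor x s) (E : mor t x) : mor t s :=
  Sub (val E :|: val F) (mor_comp_subproof F E).

Lemma split_right_subproof t s (h : mor t s) (G : {set {set I}}) : G \subset val h ->
  (G \subset edges t) && (contract_class t G == contract_class t G).
Proof.
by move=> Gh; rewrite eqxx andbT; case/andP: (valP h) => ht _; exact: subset_trans Gh ht.
Qed.

Lemma split_left_subproof t s (h : mor t s) (G : {set {set I}}) : G \subset val h ->
  (val h :\: G \subset edges (contract_class t G)) &&
  (contract_class (contract_class t G) (val h :\: G) == s).
Proof.
move=> Gh; case/andP: (valP h) => ht /eqP hs.
rewrite edges_contract setSD //= contractU.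
suff -> : G :|: (val h :\: G) = val h by rewrite hs.
by apply/setP => X; rewrite !inE; have [/(subsetP Gh)|] := boolP (X \in G).
Qed.

End Objects.

Import GRing.Theory.
Local Open Scope ring_scope.

(* The linear extension to {malg k[B]}, the k-vector space with basis B, of a
   function defined on B. *)
Definition mlin (k : fieldType) (B : choiceType) (V : lmodType k) (f : B -> V)
    (g : {malg k[B]}) : V :=
  \sum_(b <- msupp g) g@_b *: f b.

Definition is_linear (k : fieldType) (U V : lmodType k) (f : U -> V) : Prop :=
  forall (a : k) (u v : U), f (a *: u + v) = a *: f u + f v.

(* V is the direct sum of the subspaces P n, n : int. *)
Record is_grading (k : fieldType) (V : lmodType k) (P : int -> V -> Prop) : Prop :=
  IsGrading {
  grading0 : forall n, P n 0;
  grading_lin : forall n (a : k) u v, P n u -> P n v -> P n (a *: u + v);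
  grading_total : forall v, exists (r : seq int) (c : int -> V),
    (forall n, P n (c n)) /\ v = \sum_(n <- r) c n;
  grading_direct : forall (r : seq int) (c : int -> V), uniq r ->
    (forall n, P n (c n)) -> \sum_(n <- r) c n = 0 -> forall n, n \in r -> c n = 0 }.

(* Operations of a graded k-linear category with object set O; [hdeg n f] says
   that f is homogeneous of degree n, and [comp f g] is f after g. *)
Record gcat (k : fieldType) (O : Type) := GCat {
  hom : O -> O -> lmodType k;
  hdeg : forall t s, int -> hom t s -> Prop;
  idm : forall t, hom t t;
  comp : forall t x s, hom x s -> hom t x -> hom t s }.

Record dgcat (k : fieldType) (O : Type) := DGCat {
  ugcat :> gcat k O;
  diff : forall t s, hom ugcat t s -> hom ugcat t s }.

Arguments hdeg {k O g t s} _ _.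
Arguments idm {k O g} t.
Arguments comp {k O g t x s} _ _.
Arguments diff {k O d t s} _.

Record is_gcat (k : fieldType) (O : Type) (C : gcat k O) : Prop := IsGCat {
  hom_grading : forall t s, is_grading (@hdeg k O C t s);
  comp_linl : forall t x s (g : hom C t x), is_linear (fun f : hom C x s => comp f g);
  comp_linr : forall t x s (f : hom C x s), is_linear (fun g : hom C t x => comp f g);
  comp_assoc : forall t x y s (f : hom C y s) (g : hom C x y) (h : hom C t x),
    comp f (comp g h) = comp (comp f g) h;
  comp_idl : forall t s (f : hom C t s), comp (idm s) f = f;
  comp_idr : forall t s (f : hom C t s), comp f (idm t) = f;
  idm_deg : forall t, hdeg 0 (idm t : hom C t t);
  comp_deg : forall t x s (f : hom C x s) (g : hom C t x) m n,
    hdeg m f -> hdeg n g -> hdeg (m + n) (comp f g) }.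

Record is_dgcat (k : fieldType) (O : Type) (C : dgcat k O) : Prop := IsDGCat {
  dg_gcat : is_gcat C;
  diff_lin : forall t s, is_linear (@diff k O C t s);
  diff_deg : forall t s n (f : hom C t s), hdeg n f -> hdeg (n - 1) (diff f);
  diff_diff : forall t s (f : hom C t s), diff (diff f) = 0;
  diff_comp : forall t x s (f : hom C x s) (g : hom C t x) m, hdeg m f ->
    diff (comp f g) = comp (diff f) g + (-1) ^ m *: comp f (diff g) }.

(* Only functors that are the identity on objects are needed. *)
Record is_gfunctor (k : fieldType) (O : Type) (C D : gcat k O)
    (F : forall t s, hom C t s -> hom D t s) : Prop := IsGFunctor {
  fun_lin : forall t s, is_linear (F t s);
  fun_deg : forall t s n (f : hom C t s), hdeg n f -> hdeg n (F t s f);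
  fun_id : forall t, F t t (idm t) = idm t;
  fun_comp : forall t x s (f : hom C x s) (g : hom C t x),
    F t s (comp f g) = comp (F x s f) (F t x g) }.

Definition is_dgfunctor (k : fieldType) (O : Type) (C D : dgcat k O)
    (F : forall t s, hom C t s -> hom D t s) : Prop :=
  is_gfunctor F /\ forall t s (f : hom C t s), F t s (diff f) = diff (F t s f).

(* F induces, for all t and s and in every degree n, an injection and a surjection
   on the homology of the complexes of morphisms from t to s. *)
Definition is_quasi_iso (k : fieldType) (O : Type) (C D : dgcat k O)
    (F : forall t s, hom C t s -> hom D t s) : Prop :=
  forall t s n,
  (forall z : hom C t s, hdeg n z -> diff z = 0 ->
     (exists2 w : hom D t s, hdeg (n + 1) w & diff w = F t s z) ->
     exists2 w : hom C t s, hdeg (n + 1) w & diff w = z) /\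
  (forall y : hom D t s, hdeg n y -> diff y = 0 ->
     exists2 z : hom C t s, hdeg n z /\ diff z = 0 &
     exists2 w : hom D t s, hdeg (n + 1) w & diff w = F t s z - y).

(* A graph of graded vector spaces with zero differential, given by homogeneous
   bases: its value at (t, s) is {malg k[basis t s]}. *)
Record bgraph (O : Type) := BGraph {
  basis : O -> O -> choiceType;
  bdeg : forall t s, basis t s -> int }.

Arguments bdeg {O b t s} _.

Definition gspace (k : fieldType) (O : Type) (G : bgraph O) (t s : O) : lmodType k :=
  {malg k[basis G t s]}.

Definition gspace_deg (k : fieldType) (O : Type) (G : bgraph O) (t s : O) (n : int)
    (v : gspace k G t s) : Prop :=
  forall b, b \in msupp v -> bdeg b = n.

Definition is_free_on (k : fieldType) (O : Type) (C : gcat k O) (G : bgraph O)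
    (i : forall t s, gspace k G t s -> hom C t s) : Prop :=
  [/\ forall t s, is_linear (i t s),
      forall t s n (v : gspace k G t s), gspace_deg n v -> hdeg n (i t s v) &
      forall (D : gcat k O) (phi : forall t s, gspace k G t s -> hom D t s),
        is_gcat D -> (forall t s, is_linear (phi t s)) ->
        (forall t s n (v : gspace k G t s), gspace_deg n v -> hdeg n (phi t s v)) ->
        exists F : forall t s, hom C t s -> hom D t s,
          [/\ is_gfunctor F, forall t s v, F t s (i t s v) = phi t s v &
              forall F' : (forall t s, hom C t s -> hom D t s), is_gfunctor F' ->
                (forall t s v, F' t s (i t s v) = phi t s v) ->
                forall t s f, F' t s f = F t s f]].

Definition offdiag (O : eqType) (G : bgraph O) : bgraph O :=
  BGraph (fun t s (b : {_ : basis G t s | t != s}) => bdeg (val b)).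

Definition to_offdiag (O : eqType) (G : bgraph O) (t s : O) (b : basis G t s) :
    option (basis (offdiag G) t s) :=
  insub b.

Lemma to_offdiagT (O : eqType) (G : bgraph O) (t s : O) (b : basis G t s) :
  t != s -> exists2 b', to_offdiag b = Some b' & val b' = b.
Proof.
by move=> ts; rewrite /to_offdiag; case: insubP => [b' _ E|/negP []]; first by exists b'.
Qed.

Definition desuspension (O : Type) (G : bgraph O) : bgraph O :=
  BGraph (fun t s (b : basis G t s) => bdeg b - 1).

(* The basis b_1 (x) ... (x) b_m of the summands of F(G)(t, s): the factor b_1,
   which is composed last, is the outermost constructor. *)
Inductive gpath (O : Type) (B : O -> O -> Type) (t : O) : O -> Type :=
| gnil : gpath B t t
| gcons : forall x s, B x s -> gpath B t x -> gpath B t s.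

Arguments gnil {O B t}.
Arguments gcons {O B t x s} _ _.

Fixpoint gcat_path (O : Type) (B : O -> O -> Type) (t x s : O) (p : gpath B x s) :
    gpath B t x -> gpath B t s :=
  match p with
  | gnil => fun q => q
  | gcons _ _ b p' => fun q => gcons b (gcat_path p' q)
  end.

Fixpoint path_length (O : Type) (B : O -> O -> Type) (t s : O) (p : gpath B t s) : nat :=
  if p is gcons _ _ _ q then (path_length q).+1 else 0.

Fixpoint path_deg (O : Type) (G : bgraph O) (t s : O) (p : gpath (basis G) t s) : int :=
  if p is gcons _ _ b q then bdeg b + path_deg q else 0.

Section PathChoice.
Variables (O : choiceType) (B : O -> O -> choiceType) (t : O).

Fixpoint path_code s (p : gpath B t s) : seq {x : O & {y : O & B x y}} :=
  match p with
  | gnil => [::]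
  | gcons x s b q => existT _ x (existT _ s b) :: path_code q
  end.

Fixpoint path_decode (w : seq {x : O & {y : O & B x y}}) : option {s : O & gpath B t s} :=
  match w with
  | [::] => Some (existT _ t gnil)
  | existT x (existT y b) :: w' =>
    if path_decode w' is Some (existT z q) then
      match z =P x with
      | ReflectT e => Some (existT _ y (gcons b (ecast z (gpath B t z) e q)))
      | ReflectF _ => None
      end
    else None
  end.

Definition path_decode_to s (w : seq {x : O & {y : O & B x y}}) : option (gpath B t s) :=
  if path_decode w is Some (existT z q) then
    if z =P s is ReflectT e then Some (ecast z (gpath B t z) e q) else None
  else None.

Lemma path_codeK s : pcancel (@path_code s) (@path_decode_to s).
Proof.
move=> p; rewrite /path_decode_to.
suff -> : path_decode (path_code p) = Some (existT _ s p).
  by case: eqP => // e; rewrite eq_axiomK.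
elim: p => //= x y b q ->; case: eqP => // e.
by rewrite (eq_irrelevance e (erefl x)).
Qed.

HB.instance Definition _ s := Choice.copy (gpath B t s) (pcan_type (@path_codeK s)).
End PathChoice.

Section FreeCategory.
Variables (k : fieldType) (O : choiceType) (G : bgraph O).

Definition free_hom (t s : O) : lmodType k := {malg k[gpath (basis G) t s]}.

Definition free_cat : gcat k O :=
  @GCat k O free_hom
    (fun t s n (f : free_hom t s) => forall p, p \in msupp f -> path_deg p = n)
    (fun t => << gnil >>)
    (fun t x s (f : free_hom x s) (g : free_hom t x) =>
       mlin (fun p => mlin (fun q => << gcat_path p q >> : free_hom t s) g) f).

Definition path_elt (t s : O) (p : gpath (basis G) t s) : hom free_cat t s :=
  (<< p >> : free_hom t s).

Definition free_gen (t s : O) (v : gspace k G t s) : hom free_cat t s :=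
  mlin (fun b => path_elt (gcons b gnil)) v.

(* f is a sum of compositions of at least two generators. *)
Definition decomposable (t s : O) (f : hom free_cat t s) : Prop :=
  forall p, p \in msupp (f : free_hom t s) -> (1 < path_length p)%N.

Fixpoint derivation_path (d : forall t s, basis G t s -> hom free_cat t s)
    (t s : O) (p : gpath (basis G) t s) : hom free_cat t s :=
  match p with
  | gnil => 0
  | gcons x s b q =>
      comp (d x s b) (path_elt q)
      + (-1) ^ bdeg b *: comp (path_elt (gcons b gnil)) (derivation_path d q)
  end.

Definition derivation d (t s : O) (f : hom free_cat t s) : hom free_cat t s :=
  mlin (@derivation_path d t s) f.

Fixpoint extension_path (D : gcat k O) (phi : forall t s, basis G t s -> hom D t s)
    (t s : O) (p : gpath (basis G) t s) : hom D t s :=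
  match p with
  | gnil => idm t
  | gcons x s b q => comp (phi x s b) (extension_path phi q)
  end.

Definition extension (D : gcat k O) phi (t s : O) (f : hom free_cat t s) : hom D t s :=
  mlin (@extension_path D phi t s) f.

End FreeCategory.

(* Basis of the direct sum over x of the spaces R(x, s) (x) R(t, x). *)
Definition tensor_basis (O : choiceType) (R : bgraph O) (t s : O) : choiceType :=
  {x : O & (basis R x s * basis R t x)%type}.

(* The data of a graded cocategory (with zero differential) entering its cobar
   construction. *)
Record cocat (k : fieldType) (O : choiceType) := Cocat {
  cograph :> bgraph O;
  cocomp : forall t s, basis cograph t s -> {malg k[tensor_basis cograph t s]} }.

Section Cobar.
Variables (k : fieldType) (O : choiceType) (R : cocat k O).

Definition cobar_graph : bgraph O := desuspension (offdiag R).

(* The term of the differential coming from the basis element a (x) c of R (x) R.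
   It vanishes if a or c lies on the diagonal: only the reduced co-composition
   contributes. *)
Definition cobar_term (t s : O) (u : tensor_basis R t s) : hom (free_cat k cobar_graph) t s :=
  let: existT x (a, c) := u in
  match to_offdiag a, to_offdiag c with
  | Some a', Some c' =>
      (-1) ^ (bdeg a + 1) *: path_elt (G := cobar_graph) k (gcons a' (gcons c' gnil))
  | _, _ => 0
  end.

Definition cobar_gen (t s : O) (b : basis cobar_graph t s) : hom (free_cat k cobar_graph) t s :=
  mlin (@cobar_term t s) (cocomp (val b)).

Definition cobar : dgcat k O := DGCat (derivation cobar_gen).

End Cobar.

Section TreeCategory.
Variables (k : fieldType) (I : finType).

Local Notation T := (tree_class I).

Definition ktree_hom (t s : T) : lmodType k := {malg k[mor t s]}.

(* k T_I, as a dg category concentrated in degree 0. *)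
Definition ktree : dgcat k T :=
  DGCat (ugcat := @GCat k T ktree_hom
    (fun t s n (f : ktree_hom t s) => forall E, E \in msupp f -> 0 = n)
    (fun t => << mor_id t >>)
    (fun t x s (f : ktree_hom x s) (g : ktree_hom t x) =>
       mlin (fun F => mlin (fun E => << mor_comp F E >> : ktree_hom t s) g) f))
    (fun t s f => 0).

(* The line K(t, t/E), the top exterior power of k[E], has basis the monomial
   e_1 /\ ... /\ e_n, where e_1, ..., e_n are the elements of E listed in the order
   of [enum_val], which is the restriction to E of a fixed total order on {set I}. *)
Definition Kgraph : bgraph T := BGraph (fun t s (E : mor t s) => (#|val E| : int)).

Definition edge_at (E : {set {set I}}) (i : 'I_#|E|) : {set I} := enum_val i.

Definition is_shuffle (n p : nat) (sigma : 'S_n) : bool :=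
  [forall i : 'I_n, forall j : 'I_n,
     ((i < j) && ((j < p) || (p <= i)) ==> (sigma i < sigma j))%N].

Definition shuffle_right (E : {set {set I}}) (p : nat) (sigma : 'S_#|E|) : {set {set I}} :=
  [set edge_at (sigma i) | i : 'I_#|E| & (p <= i)%N].

Lemma shuffle_right_sub (E : {set {set I}}) p (sigma : 'S_#|E|) : shuffle_right p sigma \subset E.
Proof. by apply/subsetP => X /imsetP[i _ ->]; exact: enum_valP. Qed.

Definition shuffle_left (E : {set {set I}}) (p : nat) (sigma : 'S_#|E|) : {set {set I}} :=
  [set edge_at (sigma i) | i : 'I_#|E| & (i < p)%N].

Lemma shuffle_leftE (E : {set {set I}}) p (sigma : 'S_#|E|) : shuffle_left p sigma = E :\: shuffle_right p sigma.
Proof.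
apply/setP => X; rewrite inE; apply/imsetP/andP.
  case=> i; rewrite inE => ip ->; split; last exact: enum_valP.
  apply/negP => /imsetP[j]; rewrite inE => pj /enum_val_inj/perm_inj E'.
  by move: ip; rewrite E' ltnNge pj.
case=> XR XE; pose i := (sigma^-1)%g (enum_rank_in XE X).
have EX : X = edge_at (sigma i) by rewrite /i permKV /edge_at enum_rankK_in.
exists i => //; rewrite inE ltnNge; apply: contra XR => pi.
by apply/imsetP; exists i; rewrite ?inE.
Qed.

Lemma shuffle_left_subproof t s (h : mor t s) p (sigma : 'S_#|(val h : {set {set I}})|) :
  (shuffle_left p sigma \subset edges (contract_class t (shuffle_right p sigma))) &&
  (contract_class (contract_class t (shuffle_right p sigma)) (shuffle_left p sigma) == s).
Proof. by rewrite shuffle_leftE; apply/split_left_subproof/shuffle_right_sub. Qed.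

Definition left_factor t s (h : mor t s) (p : nat) (sigma : 'S_#|val h|) :
    mor (contract_class t (shuffle_right p sigma)) s :=
  Sub (shuffle_left p sigma) (shuffle_left_subproof p sigma).

Definition right_factor t s (h : mor t s) (p : nat) (sigma : 'S_#|val h|) :
    mor t (contract_class t (shuffle_right p sigma)) :=
  Sub (shuffle_right p sigma) (split_right_subproof (shuffle_right_sub p sigma)).

(* e_sigma(1) /\ ... /\ e_sigma(p) (x) e_sigma(p+1) /\ ... /\ e_sigma(n), in
   K(t/G, s) (x) K(t, t/G). Both monomials are increasing since sigma is a shuffle. *)
Definition shuffle_term t s (h : mor t s) (p : nat) (sigma : 'S_#|val h|) :
    tensor_basis Kgraph t s :=
  existT (fun x => (mor x s * mor t x)%type) (contract_class t (shuffle_right p sigma))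
    (left_factor p sigma, right_factor p sigma).

Arguments left_factor {t s} h p sigma.
Arguments right_factor {t s} h p sigma.
Arguments shuffle_term {t s} h p sigma.

Definition left_unit_term t s (h : mor t s) : tensor_basis Kgraph t s :=
  existT (fun x => (mor x s * mor t x)%type) s (mor_id s, h).

Definition right_unit_term t s (h : mor t s) : tensor_basis Kgraph t s :=
  existT (fun x => (mor x s * mor t x)%type) t (h, mor_id t).

(* For n = 0 the element h is the unit 1 and its co-composition is 1 (x) 1. *)
Definition Kcocomp t s (h : mor t s) : {malg k[tensor_basis Kgraph t s]} :=
  let n := #|val h| in
  if n == 0%N then << left_unit_term h >>
  else << left_unit_term h >> + << right_unit_term h >>
       + \sum_(1 <= p < n) \sum_(sigma : 'S_n | is_shuffle p sigma)
           (-1) ^+ odd_perm sigma *: << shuffle_term h p sigma >>.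

Definition Kcocat : cocat k T := Cocat (cograph := Kgraph) Kcocomp.

Definition OmegaK : dgcat k T := cobar Kcocat.

(* On generators: s^-1 e is sent to the morphism e if e is a single edge, and
   s^-1 (e_1 /\ ... /\ e_n) is sent to 0 if n >= 2. *)
Definition canonical_gen t s (b : basis (cobar_graph Kcocat) t s) : hom ktree t s :=
  if #|val (val b)| == 1%N then << val b >> : ktree_hom t s else 0.

Definition canonical_functor t s (f : hom OmegaK t s) : hom ktree t s :=
  extension canonical_gen f.

Definition OmegaK_gen t s (v : gspace k (cobar_graph Kcocat) t s) : hom OmegaK t s :=
  free_gen v.

End TreeCategory.

Arguments left_factor {I t s} h p sigma.
Arguments right_factor {I t s} h p sigma.
Arguments shuffle_term {I t s} h p sigma.

(* Main.v *)
Require Import Defs.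
From HB Require Import structures.
From mathcomp Require Import perm all_boot all_order all_algebra finmap monalg zify.
Import Defs.
Set Implicit Arguments. Unset Strict Implicit. Unset Printing Implicit Defensive.
Import GRing.Theory Num.Theory.
Local Open Scope ring_scope.

(** A morphism [t -> s] of the tree category is determined by the set E of edges that
    it contracts, so a path of generators of Omega(K) from t to s = t/E is the same
    thing as an ordered partition of E into nonempty blocks (blocks_composition,
    blocks_inj, blocks_surj). Listing the blocks of a path as a word embeds every
    complex Omega(K)(t, s) into one and the same complex: it is spanned by the words
    in finite sets, and its differential replaces a block B by all the L, G with
    B = L u G a disjoint union, up to sign (encode_diff). What the trees contribute is
    gone after this step; what is left is the cellular chain complex of the
    permutohedron on E. The comparison rests on the fact that (p, n-p)-shuffles
    correspond to splittings of an n-element set, with the parity of a shuffle equal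
    to that of the number of inversions between the two parts (sum_shuffles); this
    parity is read off from Vandermonde determinants (odd_perm_inversions). The
    exponents of the signs then become additive functions of the sets involved, and
    all sign identities are congruences modulo 2.

    The square of the differential vanishes by coassociativity (split_signA,
    dwords_dword). For acyclicity, fix e in E. On words w that do not contain e,
    adjoining e to one block at a time, with signs, is an odd derivation delta with
    d delta + delta d = [-, {e}], since the terms of d (B u {e}) which isolate e are
    B {e} and {e} B. Therefore the map sending u {e} v to delta(u) v, and killing the
    words in which e lies in a larger block, is a homotopy between the identity and
    the map that moves {e} to the front (homotopy). The latter is deletion of {e}, a
    chain map to the complex of E minus e (delete_dwords), followed by multiplication
    by {e}. By induction on E, a cycle is a boundary once its augmentation vanishes
    (composition_exact). The canonical functor is the augmentation, through the
    encoding (canonicalE), and an ordering of E by singletons shows that it is onto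
    in homology; so it is a quasi-isomorphism.

    Freeness, the Leibniz rule and the functoriality of the canonical functor are
    formal and are proved for the free graded category on any graph with a homogeneous
    basis. Decomposability of the differential is visible on its definition. *)

(** * Linear maps and supports in a space with basis *)

Section LinearExtension.
Variables (k : fieldType) (B : choiceType).
Implicit Types (V : lmodType k) (g : {malg k[B]}).

Lemma mlin_wide V (f : B -> V) g (d : {fset B}) : (msupp g `<=` d)%fset ->
  mlin f g = \sum_(b <- d) g@_b *: f b.
Proof.
move=> gd; rewrite /mlin; apply: (big_fset_incl _ gd) => b _ bg.
by rewrite mcoeff_outdom // scale0r.
Qed.

Lemma mlin_is_linear V (f : B -> V) : is_linear (mlin f).
Proof.
move=> a u v; have leu : (msupp u `<=` msupp u `|` msupp v)%fset by exact: fsubsetUl.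
have lev : (msupp v `<=` msupp u `|` msupp v)%fset by exact: fsubsetUr.
have leD : (msupp (a *: u + v) `<=` msupp u `|` msupp v)%fset.
  apply: fsubset_trans (msuppD_le _ _) _.
  by rewrite fsubUset lev andbT; exact: fsubset_trans (msuppZ_le _ _) leu.
rewrite (mlin_wide f leD) (mlin_wide f leu) (mlin_wide f lev) scaler_sumr -big_split /=.
by apply: eq_bigr => b _; rewrite mcoeffD mcoeffZ scalerDl scalerA.
Qed.

HB.instance Definition _ V (f : B -> V) :=
  GRing.isLinear.Build k {malg k[B]} V *:%R (@mlin k B V f) (@mlin_is_linear V f).

Lemma mlinU V (f : B -> V) b : mlin f << b >> = f b.
Proof. by rewrite /mlin msuppU oner_eq0 big_seq_fset1 mcoeffUU scale1r. Qed.

Lemma eq_mlin V (f h : B -> V) g : (forall b, b \in msupp g -> f b = h b) -> mlin f g = mlin h g.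
Proof. by move=> E; rewrite /mlin !big_seq; apply: eq_bigr => b /E ->. Qed.

Lemma linear_mlin V (W : lmodType k) (L : {linear V -> W}) (f : B -> V) g :
  L (mlin f g) = mlin (fun b => L (f b)) g.
Proof. by rewrite linear_sum; apply: eq_bigr => b _; rewrite linearZ. Qed.

Lemma malg_sum g : g = mlin (fun b => << b >>) g.
Proof.
rewrite [LHS]monalgE; apply: eq_bigr => b _; apply/malgP => c.
by rewrite mcoeffZ !mcoeffU mulr_natr.
Qed.

Lemma linear_malg V (L : {linear {malg k[B]} -> V}) g : L g = mlin (fun b => L << b >>) g.
Proof. by rewrite {1}[g]malg_sum linear_mlin. Qed.

Lemma eq_linear V (L M : {linear {malg k[B]} -> V}) g :
  (forall b, b \in msupp g -> L << b >> = M << b >>) -> L g = M g.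
Proof. by move=> E; rewrite linear_malg [RHS]linear_malg; exact: eq_mlin. Qed.

Definition supported (P : B -> Prop) g := forall b, b \in msupp g -> P b.

Variable P : B -> Prop.

Lemma supported0 : supported P 0.
Proof. by move=> b; rewrite msupp0. Qed.

Lemma supportedU b : P b -> supported P << b >>.
Proof. by move=> Pb c; rewrite msuppU oner_eq0 inE => /eqP->. Qed.

Lemma supportedD u v : supported P u -> supported P v -> supported P (u + v).
Proof. by move=> Pu Pv b /(fsubsetP (msuppD_le _ _)); rewrite inE => /orP[/Pu|/Pv]. Qed.

Lemma supportedZ a u : supported P u -> supported P (a *: u).
Proof. by move=> Pu b /(fsubsetP (msuppZ_le _ _))/Pu. Qed.

Lemma supported_sum (J : eqType) (r : seq J) (Q : pred J) (F : J -> {malg k[B]}) :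
  (forall j, j \in r -> Q j -> supported P (F j)) -> supported P (\sum_(j <- r | Q j) F j).
Proof.
move=> PF; rewrite big_seq_cond; apply: (big_ind (supported P)) => //.
- exact: supported0.
- exact: supportedD.
- by move=> j /andP[]; exact: PF.
Qed.

Lemma supported_mlin (C : choiceType) (Q : C -> Prop) (f : C -> {malg k[B]}) (g : {malg k[C]}) :
  (forall c, Q c -> supported P (f c)) -> (forall c, c \in msupp g -> Q c) ->
  supported P (mlin f g).
Proof. by move=> fP gQ; apply: supported_sum => c /gQ/fP Pc _; exact: supportedZ. Qed.

End LinearExtension.

(** ** Closure properties of linearity *)

Section Linearity.
Variable k : fieldType.
Implicit Types U V W : lmodType k.

Lemma is_linear_id U : is_linear (fun u : U => u).
Proof. by []. Qed.

Lemma is_linear0 U V : is_linear (fun _ : U => 0 : V).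
Proof. by move=> a u v; rewrite scaler0 addr0. Qed.

Lemma is_linear_comp U V W (f : V -> W) (h : U -> V) :
  is_linear f -> is_linear h -> is_linear (fun u => f (h u)).
Proof. by move=> fl hl a u v; rewrite hl fl. Qed.

Lemma is_linearD U V (f h : U -> V) :
  is_linear f -> is_linear h -> is_linear (fun u => f u + h u).
Proof. by move=> fl hl a u v; rewrite fl hl scalerDr addrACA. Qed.

Lemma is_linearN U V (f : U -> V) : is_linear f -> is_linear (fun u => - f u).
Proof. by move=> fl a u v; rewrite fl opprD scalerN. Qed.

Lemma is_linearZ U V (c : k) (f : U -> V) : is_linear f -> is_linear (fun u => c *: f u).
Proof. by move=> fl a u v; rewrite fl scalerDr !scalerA mulrC. Qed.

Lemma is_linear_sum U V (J : Type) (r : seq J) (P : pred J) (f : J -> U -> V) :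
  (forall j, is_linear (f j)) -> is_linear (fun u => \sum_(j <- r | P j) f j u).
Proof.
move=> fl a u v; rewrite scaler_sumr -big_split.
by apply: eq_bigr => j _; exact: fl.
Qed.

Lemma is_linearP U V (L : {linear U -> V}) : is_linear L.
Proof. by move=> a u v; rewrite linearP. Qed.

(** Identities between composites of linear operations are reduced by this lemma to
    basis elements; the closure properties above discharge its two hypotheses. *)
Lemma is_linear_eq (B : choiceType) V (f h : {malg k[B]} -> V) :
  is_linear f -> is_linear h -> (forall b, f << b >> = h << b >>) -> f =1 h.
Proof.
move=> fl hl E g.
pose F : {linear {malg k[B]} -> V} := HB.pack f (GRing.isLinear.Build k _ V *:%R f fl).
pose H : {linear {malg k[B]} -> V} := HB.pack h (GRing.isLinear.Build k _ V *:%R h hl).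
exact: (@eq_linear k B V F H).
Qed.

End Linearity.

(** ** Free vector spaces, up to isomorphism *)

(** A vector space with basis [B], known only by its universal property: nothing in
    the study of words depends on how linear combinations are represented. *)
Record free_space (k : fieldType) (B : Type) := FreeSpace {
  space :> lmodType k;
  elt : B -> space;
  ext : forall V : lmodType k, (B -> V) -> {linear space -> V};
  extE : forall (V : lmodType k) (f : B -> V) b, ext f (elt b) = f b;
  ext_uniq : forall (V : lmodType k) (f h : {linear space -> V}),
    (forall b, f (elt b) = h (elt b)) -> f =1 h }.

Arguments elt {k B A} _ : rename.
Arguments ext {k B A V} _ : rename.

Section FreeSpace.
Variables (k : fieldType) (B : Type) (A : free_space k B).
Implicit Types (V : lmodType k) (P Q : B -> Prop).

Lemma is_linear_ext_uniq V (f h : A -> V) :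
  is_linear f -> is_linear h -> (forall b, f (elt b) = h (elt b)) -> f =1 h.
Proof.
move=> fl hl.
pose F : {linear A -> V} := HB.pack f (GRing.isLinear.Build k _ V *:%R f fl).
pose H : {linear A -> V} := HB.pack h (GRing.isLinear.Build k _ V *:%R h hl).
exact: (@ext_uniq k B A V F H).
Qed.

(** The span of the basis elements satisfying [P] is the smallest subspace containing
    them; defined in this way it needs no coefficients. *)
Definition spanned P (a : A) : Prop := forall R : A -> Prop,
  R 0 -> (forall c u v, R u -> R v -> R (c *: u + v)) -> (forall b, P b -> R (elt b)) -> R a.

Lemma spanned_elt P b : P b -> spanned P (elt b).
Proof. by move=> Pb R _ _; exact. Qed.

Lemma spanned0 P : spanned P 0.
Proof. by []. Qed.

Lemma spanned_lin P c u v : spanned P u -> spanned P v -> spanned P (c *: u + v).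
Proof. by move=> Pu Pv R R0 Rl Re; exact: Rl (Pu R R0 Rl Re) (Pv R R0 Rl Re). Qed.

Lemma spannedD P u v : spanned P u -> spanned P v -> spanned P (u + v).
Proof. by move=> Pu Pv; rewrite -[u]scale1r; exact: spanned_lin. Qed.

Lemma spannedZ P c u : spanned P u -> spanned P (c *: u).
Proof. by move=> Pu; rewrite -[_ *: u]addr0; exact: spanned_lin Pu (@spanned0 P). Qed.

Lemma spanned_sum P (J : Type) (r : seq J) (Q : pred J) (F : J -> A) :
  (forall j, Q j -> spanned P (F j)) -> spanned P (\sum_(j <- r | Q j) F j).
Proof. by move=> PF; apply: big_ind => //; exact: spannedD. Qed.

Lemma eq_spanned P V (f h : A -> V) a : spanned P a -> is_linear f -> is_linear h ->
  (forall b, P b -> f (elt b) = h (elt b)) -> f a = h a.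
Proof.
move=> Pa fl hl E; apply: (Pa (fun a => f a = h a)) => //; last first.
  by move=> c u v Eu Ev; rewrite fl hl Eu Ev.
have lin0 g : is_linear g -> g 0 = 0 :> V.
  move=> gl; have /eqP := gl 1 0 0.
  by rewrite !scale1r addr0 -subr_eq0 opprD addNKr oppr_eq0 => /eqP.
by rewrite !lin0.
Qed.

End FreeSpace.

Lemma spanned_linear (k : fieldType) (B C : Type) (A : free_space k B) (A' : free_space k C)
    (P : B -> Prop) (Q : C -> Prop) (f : {linear A -> A'}) a :
  spanned P a -> (forall b, P b -> spanned Q (f (elt b))) -> spanned Q (f a).
Proof.
move=> Pa Pf; apply: (Pa (fun a => spanned Q (f a))) => //.
- by rewrite linear0; exact: spanned0.
- by move=> c u v Ru Rv; rewrite linearP; exact: spanned_lin.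
Qed.

Lemma is_linear_lin (k : fieldType) (U V W : lmodType k) (L : {linear V -> W})
  (h : U -> V) : is_linear h -> is_linear (fun u => L (h u)).
Proof. exact/is_linear_comp/is_linearP. Qed.

Ltac linearity := repeat first
  [ apply: is_linear_id | apply: is_linearP | apply: is_linearD | apply: is_linearN
  | apply: is_linearZ | apply: is_linear_sum => ? | apply: is_linear0 | apply: is_linear_lin ].

(** * Signs of splittings of a finite set *)

Section Signs.
Variable X : finType.
Implicit Types (A B C L G : {set X}) (e x y : X).

(** For disjoint [A] and [B], the number of transpositions of neighbours that sort the
    increasing list of [A] followed by the increasing list of [B]. *)
Definition inversions A B : nat :=
  (\sum_(x in A) \sum_(y in B) (enum_rank y < enum_rank x))%N.

Lemma inversionsUl A B C : [disjoint A & B] ->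
  inversions (A :|: B) C = (inversions A C + inversions B C)%N.
Proof. by move=> dAB; rewrite /inversions -bigU //=; apply: eq_bigl => x; rewrite !inE. Qed.

Lemma inversionsUr A B C : [disjoint B & C] ->
  inversions A (B :|: C) = (inversions A B + inversions A C)%N.
Proof.
move=> dBC; rewrite /inversions -big_split; apply: eq_bigr => x _ /=.
by rewrite -bigU //=; apply: eq_bigl => y; rewrite !inE.
Qed.

Lemma inversions_sym e B : e \notin B -> (inversions B [set e] + inversions [set e] B = #|B|)%N.
Proof.
move=> eB.
have -> : #|B| = (\sum_(x in B) 1)%N by rewrite sum1_card.
rewrite /inversions big_set1 -big_split /=; apply: eq_bigr => x xB.
rewrite big_set1; case: ltngtP => // /ord_inj/enum_rank_inj E.
by rewrite E xB in eB.
Qed.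

(** The exponent of the sign with which L (x) G occurs in the cobar differential of
    the generator s^-1 (L u G). *)
Definition split_exp L G : nat := (#|L|.+1 + inversions L G)%N.

Definition splits B L G : bool :=
  [&& L != set0, G != set0, [disjoint L & G] & L :|: G == B].

Lemma splits_card B L G : splits B L G -> (#|B| = #|L| + #|G|)%N.
Proof. by case/and4P => _ _ dLG /eqP <-; rewrite cardsU disjoint_setI0 // cards0 subn0. Qed.

Lemma splits_sub B L G : splits B L G -> (L \subset B) && (G \subset B).
Proof. by case/and4P => _ _ _ /eqP <-; rewrite subsetUl subsetUr. Qed.

Lemma splitsD B L : L \subset B -> L != set0 -> L != B -> splits B L (B :\: L).
Proof.
move=> LB L0 LnB; apply/and4P; split => //.
- rewrite setD_eq0; apply: contra LnB => BL; by rewrite eqEsubset LB.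
- by rewrite disjoints_subset; apply/subsetP => x; rewrite !inE => ->.
- by apply/eqP/setP => x; rewrite !inE; case: (boolP (x \in L)) => //= /(subsetP LB).
Qed.

Lemma splits_uniq B L G : splits B L G -> G = B :\: L.
Proof.
case/and4P => _ _ dLG /eqP <-; apply/setP => x; rewrite !inE.
by case: (boolP (x \in L)) => //= xL; rewrite (disjointFr dLG xL).
Qed.

Definition splits3 B C1 C2 C3 : bool :=
  [&& C1 != set0, C2 != set0, C3 != set0, [disjoint C1 & C2], [disjoint C1 & C3],
      [disjoint C2 & C3] & C1 :|: C2 :|: C3 == B].

Lemma splits_splitl B C1 C2 C3 L :
  splits B L C3 && splits L C1 C2 = (L == C1 :|: C2) && splits3 B C1 C2 C3.
Proof.
rewrite /splits /splits3 [C1 :|: C2 == L]eq_sym.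
case: (L =P C1 :|: C2) => [->|_]; last by rewrite !andbF.
rewrite -!setI_eq0 setIUl !setU_eq0 /=.
by do 6!case: (_ == set0); rewrite ?andbF ?andbT.
Qed.

Lemma splits_splitr B C1 C2 C3 G :
  splits B C1 G && splits G C2 C3 = (G == C2 :|: C3) && splits3 B C1 C2 C3.
Proof.
rewrite /splits /splits3 [C2 :|: C3 == G]eq_sym.
case: (G =P C2 :|: C3) => [->|_]; last by rewrite !andbF.
rewrite -!setI_eq0 setIUr !setU_eq0 setUA /=.
by do 6!case: (_ == set0); rewrite ?andbF ?andbT.
Qed.

End Signs.

Ltac parity_cases :=
  repeat match goal with |- context [odd ?n] => case: (odd n) end.

Section SignIdentities.
Variable X : finType.
Implicit Types (B L G : {set X}) (e : X).

Variable R : pzRingType.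
Definition split_sign L G : R := (-1) ^+ split_exp L G.
(** The sign of moving an odd operator past the generator s^-1 B, of degree #|B| - 1. *)
Definition block_sign B : R := (-1) ^+ #|B|.+1.

Lemma signD m n : (-1) ^+ m * (-1) ^+ n = (-1) ^+ (m + n) :> R.
Proof. by rewrite exprD. Qed.

Lemma eq_sign m n : odd m = odd n -> (-1) ^+ m = (-1) ^+ n :> R.
Proof. by move=> E; rewrite -signr_odd E signr_odd. Qed.

Lemma opp_sign m : - (-1) ^+ m = (-1) ^+ m.+1 :> R.
Proof. by rewrite exprS mulN1r. Qed.

Lemma block_sign2 B : block_sign B * block_sign B = 1.
Proof. by rewrite signD -[RHS](expr0 (-1)); apply: eq_sign; rewrite addnn odd_double. Qed.

Lemma block_signU L G : [disjoint L & G] -> block_sign (L :|: G) = - (block_sign L * block_sign G).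
Proof.
move=> dLG; rewrite signD opp_sign; apply: eq_sign; rewrite cardsU disjoint_setI0 // cards0.
by rewrite subn0 !(oddD, oddS) /=; parity_cases.
Qed.

Lemma block_sign_setU1 e B : e \notin B -> block_sign (e |: B) = - block_sign B.
Proof. by move=> eB; rewrite /block_sign cardsU1 eB opp_sign. Qed.

Lemma block_sign1 e : block_sign [set e] = 1.
Proof. by rewrite /block_sign cards1 expr2 mulrNN mulr1. Qed.

Lemma split_sign2 L G : split_sign L G * split_sign L G = 1.
Proof. by rewrite signD -[RHS](expr0 (-1)); apply: eq_sign; rewrite addnn odd_double. Qed.

(** The two ways of splitting off [e] from a block have opposite signs; deletion of
    [e] is a chain map for this reason. *)
Lemma split_sign_sym e B : e \notin B -> split_sign [set e] B = - split_sign B [set e].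
Proof.
move=> eB; rewrite opp_sign; apply: eq_sign; rewrite /split_exp cards1.
rewrite -(inversions_sym eB) !(oddD, oddS) /=.
by parity_cases.
Qed.

(** Coassociativity of the co-composition, with the Koszul sign of the cobar
    construction. *)
Lemma split_signA L1 L2 G : [disjoint L1 & L2] -> [disjoint L1 & G] -> [disjoint L2 & G] ->
  split_sign (L1 :|: L2) G * split_sign L1 L2 =
  - (block_sign L1 * (split_sign L1 (L2 :|: G) * split_sign L2 G)).
Proof.
move=> d12 d1 d2; rewrite !signD opp_sign; apply: eq_sign.
rewrite /split_exp inversionsUl // inversionsUr // cardsU disjoint_setI0 // cards0 subn0.
by rewrite /= !(oddD, oddS) /=; parity_cases.
Qed.

(** Adjoining [e] to a block and splitting that block anticommute. This is the sign
    rule when [e] ends in the left part. *)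
Lemma split_sign_insl e L G : [disjoint L & G] -> e \notin L -> e \notin G ->
  split_sign (L :|: G) [set e] * split_sign (e |: L) G = - (split_sign L G * split_sign L [set e]).
Proof.
move=> dLG eL eG; rewrite !signD opp_sign; apply: eq_sign.
have dLe : [disjoint L & [set e]] by rewrite disjoint_sym disjoints1.
rewrite /split_exp [e |: L]setUC !inversionsUl //.
rewrite cardsU disjoint_setI0 // cards0 subn0 setUC cardsU1 eL.
have /(congr1 odd) := inversions_sym eG; rewrite !(oddD, oddS) /= => <-.
by parity_cases.
Qed.

(** The same when [e] ends in the right part, so that the operator adjoining [e] has
    passed the block [L]. *)
Lemma split_sign_insr e L G : [disjoint L & G] -> e \notin L -> e \notin G ->
  split_sign (L :|: G) [set e] * split_sign L (e |: G) =
  - (block_sign L * (split_sign L G * split_sign G [set e])).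
Proof.
move=> dLG eL eG; rewrite !signD opp_sign; apply: eq_sign.
have dGe : [disjoint G & [set e]] by rewrite disjoint_sym disjoints1.
rewrite /split_exp [e |: G]setUC inversionsUl // inversionsUr //.
rewrite cardsU disjoint_setI0 // cards0 subn0.
by rewrite !(oddD, oddS) /=; parity_cases.
Qed.

End SignIdentities.

(** * Sums over splittings *)

Section SplitSums.
Variables (X : finType) (V : nmodType).
Implicit Types (B L G : {set X}) (e : X).

Definition split_sum B (f : {set X} -> {set X} -> V) : V :=
  \sum_L \sum_(G | splits B L G) f L G.

Lemma eq_split_sum B f h : (forall L G, splits B L G -> f L G = h L G) ->
  split_sum B f = split_sum B h.
Proof. by move=> E; apply: eq_bigr => L _; apply: eq_bigr => G /E. Qed.

Lemma split_sumD B f h : split_sum B f + split_sum B h = split_sum B (fun L G => f L G + h L G).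
Proof. by rewrite -big_split; apply: eq_bigr => L _; rewrite -big_split. Qed.

Lemma split_sumE B f :
  split_sum B f = \sum_(L : {set X} | [&& L \subset B, L != set0 & L != B]) f L (B :\: L).
Proof.
rewrite [RHS]big_mkcond; apply: eq_bigr => L _; case: and3P => [[LB L0 LnB]|H].
  rewrite (big_pred1 (B :\: L)) // => G /=; apply/idP/eqP => [/splits_uniq //|->].
  exact: splitsD.
rewrite big_pred0 // => G; apply/negP => sp; apply: H; have /andP[LB GB] := splits_sub sp.
case/and4P: sp => L0 G0 d /eqP E; split => //; apply: contra G0 => /eqP EL.
by rewrite -(setIidPr GB) -EL (disjoint_setI0 d).
Qed.

(** The splittings of [e |: B] are [B, {e}] and [{e}, B], and for every splitting of
    [B] the two in which [e] is adjoined to one of the parts. *)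
Lemma split_sum_setU1 e B f : e \notin B -> B != set0 ->
  split_sum (e |: B) f =
    f B [set e] + f [set e] B + split_sum B (fun L G => f (e |: L) G + f L (e |: G)).
Proof.
move=> eB B0; rewrite !split_sumE (bigID (fun L : {set X} => e \in L)) /= addrC.
have eU L : e \notin L -> (e |: L) :\ e = L by move=> eL; rewrite setU1K.
rewrite (bigD1 B) /=; last first.
  rewrite subsetUr B0 eB /= andbT; apply: contraNneq eB => ->; exact: setU11.
rewrite (_ : (e |: B) :\: B = [set e]); last first.
  by apply/setP => x; rewrite !inE; case: eqP => [->|]; rewrite ?eB // andNb.
rewrite [X in _ + _ + X = _](reindex_onto (fun L => e |: L) (fun L => L :\ e)) /=; last first.
  by move=> L /andP[_ eL]; rewrite setD1K.
rewrite [X in _ + _ + X = _](bigD1 set0) /=; last first.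
  rewrite setU0 sub1set setU11 set11 setDv eqxx !andbT /=; apply/andP; split.
    by apply/set0Pn; exists e; rewrite set11.
  apply: contra B0 => /eqP E; apply/eqP/setP => x; rewrite !inE; apply/negP => xB.
  have : x \in e |: B by rewrite inE xB orbT.
  by rewrite -E inE => /eqP Ex; rewrite Ex (negbTE eB) in xB.
rewrite setU0 (_ : (e |: B) :\ e = B) ?eU // addrACA; congr (_ + _).
have subB L : e \notin L -> (L \subset e |: B) = (L \subset B).
  by move=> eL; rewrite -[in RHS](eU B eB) subsetD1 eL andbT.
have nsubB L : e \in L -> (L \subset B) = false.
  by move=> eL; apply/negP => /subsetP/(_ e eL); rewrite (negbTE eB).
rewrite big_split /= addrC; congr (_ + _); apply: eq_big => L.
- have [eL|eL] := boolP (e \in L).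
    rewrite nsubB // [_ :\ e == L](_ : _ = false) ?andbF //.
    by apply/eqP => E; rewrite -E !inE eqxx in eL.
  rewrite eU // eqxx andbT setU11 andbT subUset sub1set setU11 subB //=.
  have -> : (e |: L != set0) by apply/set0Pn; exists e; rewrite setU11.
  rewrite (_ : (e |: L == e |: B) = (L == B)) 1?[LHS]andbAC ?andbT; last first.
    by apply/eqP/eqP => [E|->] //; rewrite -(eU L eL) E eU.
  by case: (L \subset B) => //=; rewrite andbC.
- case/andP => /andP[/andP[_ _] _] _; congr f; apply/setP => x; rewrite !inE.
  have [->|] := eqVneq x e => //=; by rewrite (negbTE eB) andbF.
- have [eL|eL] := boolP (e \in L); first by rewrite nsubB // andbF.
  rewrite subB // andbT -!andbA; congr [&& _, _ & _].
  by case: (L =P e |: B) eL => [->|_ _] //=; rewrite setU11.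
- case/andP => /andP[_ eL] _; congr f; apply/setP => x; rewrite !inE.
  by have [->|] := eqVneq x e => //=; rewrite eL.
Qed.

Let if_sum2 (b : bool) (F : {set X} -> {set X} -> V) :
  (if b then \sum_L \sum_G F L G else 0) = \sum_L \sum_G (if b then F L G else 0).
Proof. by case: b => //; rewrite big1 // => L _; rewrite big1. Qed.

Let split_sum_if B f : split_sum B f = \sum_L \sum_G (if splits B L G then f L G else 0).
Proof. by apply: eq_bigr => L _; rewrite big_mkcond. Qed.

Let sum_forced (c : bool) S (x : V) :
  \sum_(L : {set X}) (if (L == S) && c then x else 0) = if c then x else 0.
Proof.
rewrite (bigD1 S) //= eqxx /= big1 ?addr0 // => L /negbTE ->; by case: c.
Qed.

(** Splitting the left part again, or the right part, runs over the decompositions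
    into three blocks. *)
Lemma split_suml B (f : {set X} -> {set X} -> {set X} -> V) :
  split_sum B (fun L C3 => split_sum L (fun C1 C2 => f C1 C2 C3)) =
  \sum_C1 \sum_C2 \sum_C3 (if splits3 B C1 C2 C3 then f C1 C2 C3 else 0).
Proof.
rewrite split_sum_if.
under eq_bigr => L _ do under eq_bigr => C3 _ do rewrite split_sum_if if_sum2.
transitivity (\sum_C3 \sum_C1 \sum_C2 (if splits3 B C1 C2 C3 then f C1 C2 C3 else 0)).
  rewrite exchange_big; apply: eq_bigr => C3 _.
  rewrite exchange_big; apply: eq_bigr => C1 _.
  rewrite exchange_big; apply: eq_bigr => C2 _ /=.
  rewrite -(sum_forced _ (C1 :|: C2)); apply: eq_bigr => L _.
  by rewrite -splits_splitl; case: splits.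
rewrite exchange_big; apply: eq_bigr => C1 _.
by rewrite exchange_big.
Qed.

Lemma split_sumr B (f : {set X} -> {set X} -> {set X} -> V) :
  split_sum B (fun C1 G => split_sum G (fun C2 C3 => f C1 C2 C3)) =
  \sum_C1 \sum_C2 \sum_C3 (if splits3 B C1 C2 C3 then f C1 C2 C3 else 0).
Proof.
rewrite split_sum_if; apply: eq_bigr => C1 _.
under eq_bigr => L _ do rewrite split_sum_if if_sum2.
rewrite exchange_big; apply: eq_bigr => C2 _.
rewrite exchange_big; apply: eq_bigr => C3 _ /=.
rewrite -(sum_forced _ (C2 :|: C3)); apply: eq_bigr => L _.
by rewrite -splits_splitr; case: splits.
Qed.

Lemma split_sum_assoc B (f h : {set X} -> {set X} -> {set X} -> V) :
  (forall C1 C2 C3, splits3 B C1 C2 C3 -> f C1 C2 C3 = h C1 C2 C3) ->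
  split_sum B (fun L C3 => split_sum L (fun C1 C2 => f C1 C2 C3)) =
  split_sum B (fun C1 G => split_sum G (fun C2 C3 => h C1 C2 C3)).
Proof.
move=> E; rewrite split_suml split_sumr.
apply: eq_bigr => C1 _; apply: eq_bigr => C2 _; apply: eq_bigr => C3 _.
by case: ifP => // /E.
Qed.

End SplitSums.

Lemma raddf_split_sum (X : finType) (U V : nmodType) (h : {additive U -> V}) (B : {set X}) f :
  h (split_sum B f) = split_sum B (fun L G => h (f L G)).
Proof. by rewrite raddf_sum; apply: eq_bigr => L _; rewrite raddf_sum. Qed.

(** * The complex of words of blocks *)

Section Words.
Variables (k : fieldType) (X : finType).
Local Notation word := (seq {set X}).
Variable A : free_space k word.
Implicit Types (B C L G E : {set X}) (e : X) (w : word) (a x : A).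

Local Notation sg B := (block_sign k B).
Local Notation cs L G := (split_sign k L G).

Definition block_mul B : {linear A -> A} := ext (fun w => elt (B :: w)).

Fixpoint dword w : A :=
  if w is B :: w' then
    split_sum B (fun L G => cs L G *: elt (L :: G :: w')) + sg B *: block_mul B (dword w')
  else 0.

Definition dwords : {linear A -> A} := ext dword.

Lemma block_mulE B w : block_mul B (elt w) = elt (B :: w).
Proof. exact: extE. Qed.

Lemma dwordsE w : dwords (elt w) = dword w.
Proof. exact: extE. Qed.

Lemma dwords_mul B x : dwords (block_mul B x) =
  split_sum B (fun L G => cs L G *: block_mul L (block_mul G x)) + sg B *: block_mul B (dwords x).
Proof.
move: x; apply: is_linear_ext_uniq; rewrite /split_sum; linearity.
move=> w; rewrite block_mulE !dwordsE /=; congr (_ + _).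
by apply: eq_split_sum => L G _; rewrite !block_mulE.
Qed.

(** The two orders in which a block is split twice cancel by coassociativity; the
    terms in which two different blocks are split cancel by the Koszul sign. *)
Lemma dwords_dword w : dwords (dword w) = 0.
Proof.
elim: w => [|B w IHw] /=; first by rewrite linear0.
rewrite linearD linearZ /= dwords_mul IHw linear0 scaler0 addr0.
rewrite raddf_split_sum.
pose t C1 C2 C3 : A := block_mul C1 (block_mul C2 (block_mul C3 (elt w))).
have E L G : splits B L G -> dwords (cs L G *: elt [:: L, G & w]) =
    split_sum L (fun L1 L2 => (cs (L1 :|: L2) G * cs L1 L2) *: t L1 L2 G)
    + (split_sum G (fun G1 G2 => (cs L (G1 :|: G2) * (sg L * cs G1 G2)) *: t L G1 G2)
    + - (sg B * cs L G) *: block_mul L (block_mul G (dword w))).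
  move=> sp; rewrite linearZ -!block_mulE !dwords_mul dwordsE linearD linearZ /=.
  rewrite !raddf_split_sum !scalerDr !scalerA !raddf_split_sum; congr (_ + (_ + _)).
  - by apply: eq_split_sum => L1 L2 /and4P[_ _ _ /eqP ->] /=; rewrite scalerA.
  - by apply: eq_split_sum => L1 L2 /and4P[_ _ _ /eqP ->] /=; rewrite linearZ /= !scalerA mulrA.
  - congr (_ *: _); have /and4P[_ _ d /eqP <-] := sp; rewrite block_signU // mulNr opprK.
    by rewrite [RHS]mulrC mulrA.
have -> : sg B *: split_sum B (fun L G => cs L G *: block_mul L (block_mul G (dword w))) =
    split_sum B (fun L G => (sg B * cs L G) *: block_mul L (block_mul G (dword w))).
  by rewrite raddf_split_sum; apply: eq_split_sum => L G _ /=; rewrite scalerA.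
rewrite (eq_split_sum E) -!split_sumD -!addrA.
rewrite (@split_sum_assoc _ _ _
  (fun C1 C2 C3 => (cs (C1 :|: C2) C3 * cs C1 C2) *: t C1 C2 C3) (fun C1 G1 G2 =>
  - (cs C1 (G1 :|: G2) * (sg C1 * cs G1 G2)) *: t C1 G1 G2)); last first.
  move=> C1 C2 C3 /and5P[_ _ _ d12 /and3P[d13 d23 _]]; congr (_ *: _).
  by rewrite split_signA // mulrCA mulrA.
rewrite !split_sumD; apply: big1 => L _; apply: big1 => G sp.
rewrite scaleNr addNr addr0 split_sumD; apply: big1 => G1 _; apply: big1 => G2 _.
by rewrite scaleNr addNr.
Qed.

Lemma dwords2 x : dwords (dwords x) = 0.
Proof.
move: x; apply: is_linear_ext_uniq; linearity.
by move=> w; rewrite dwordsE dwords_dword.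
Qed.

(** ** Contracting the complex along one element *)

Section Contraction.
Variable e : X.

(** Sends [u {e} v] to [u v], and a word whose first block containing [e] has other
    elements to 0. *)
Fixpoint delete_word w : A :=
  if w is B :: w' then
    if B == [set e] then elt w' else if e \in B then 0 else block_mul B (delete_word w')
  else 0.

Definition delete : {linear A -> A} := ext delete_word.

(** Sends [u {e} v] to [delta(u) v], where [delta] is the derivation that adjoins [e]
    on the right of a block, and a word whose first block containing [e] has other
    elements to 0. The first summand is [delta(B)] times the rest of the word with
    [{e}] deleted. The sign is the one that makes [B {e}] occur with coefficient 1 in
    the differential of [delta(B)]. *)
Fixpoint absorb_word w : A :=
  if w is B :: w' then
    if e \in B then 0
    else cs B [set e] *: block_mul (e |: B) (delete_word w') + sg B *: block_mul B (absorb_word w')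
  else 0.

Definition absorb : {linear A -> A} := ext absorb_word.

Lemma deleteE w : delete (elt w) = delete_word w.
Proof. exact: extE. Qed.

Lemma absorbE w : absorb (elt w) = absorb_word w.
Proof. exact: extE. Qed.

Lemma delete_mul1 x : delete (block_mul [set e] x) = x.
Proof.
move: x; apply: is_linear_ext_uniq; linearity.
by move=> w; rewrite block_mulE deleteE /= eqxx.
Qed.

Lemma delete_mulin B x : e \in B -> B != [set e] -> delete (block_mul B x) = 0.
Proof.
move=> eB nB; move: x; apply: is_linear_ext_uniq; linearity.
by move=> w; rewrite block_mulE deleteE /= (negbTE nB) eB.
Qed.

Lemma delete_mulout B x : e \notin B -> delete (block_mul B x) = block_mul B (delete x).
Proof.
move=> eB; move: x; apply: is_linear_ext_uniq; linearity.
move=> w; rewrite block_mulE !deleteE /= (negbTE eB).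
by case: eqP eB => // ->; rewrite set11.
Qed.

Lemma absorb_mulin B x : e \in B -> absorb (block_mul B x) = 0.
Proof.
move=> eB; move: x; apply: is_linear_ext_uniq; linearity.
by move=> w; rewrite block_mulE absorbE /= eB.
Qed.

Lemma absorb_mulout B x : e \notin B -> absorb (block_mul B x) =
  cs B [set e] *: block_mul (e |: B) (delete x) + sg B *: block_mul B (absorb x).
Proof.
move=> eB; move: x; apply: is_linear_ext_uniq; linearity.
by move=> w; rewrite block_mulE !absorbE deleteE /= (negbTE eB).
Qed.

Lemma setU1_neq1 B : B != set0 -> e \notin B -> e |: B != [set e].
Proof.
move=> B0 eB; apply: contra B0 => /eqP E; apply/eqP/setP => x; rewrite !inE; apply/negP => xB.
have : x \in e |: B by rewrite inE xB orbT.
by rewrite E inE => /eqP Ex; rewrite Ex (negbTE eB) in xB.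
Qed.

Lemma splits_notin B L G : e \notin B -> splits B L G -> (e \notin L) && (e \notin G).
Proof.
move=> eB /splits_sub/andP[/subsetP LB /subsetP GB].
by rewrite (contra (LB e) eB) (contra (GB e) eB).
Qed.

Lemma split_sum1 (f : {set X} -> {set X} -> A) : split_sum [set e] f = 0.
Proof.
rewrite split_sumE big_pred0 // => L.
by rewrite subset1; case: eqP => //= [->|_]; rewrite ?eqxx ?andbF //; case: (L == set0).
Qed.

(** A block [P u {e}] is killed by deletion, and the terms [P {e}] and [{e} P] of its
    differential, which are both sent to [P], have opposite signs. *)
Lemma delete_dword w : delete (dword w) = dwords (delete_word w).
Proof.
elim: w => [|B w IHw] /=; first by rewrite !linear0.
have [->|nB] := eqVneq B [set e].
  by rewrite split_sum1 add0r block_sign1 scale1r delete_mul1 dwordsE.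
rewrite linearD linearZ /= raddf_split_sum /=; have [eB|eB] := boolP (e \in B).
  rewrite linear0 delete_mulin // scaler0 addr0.
  pose P := B :\ e; have eP : e \notin P by rewrite !inE eqxx.
  have EB : B = e |: P by rewrite setD1K.
  have P0 : P != set0 by apply: contra nB => /eqP P0; rewrite EB P0 setU0.
  rewrite EB split_sum_setU1 // -!block_mulE !linearZ /= delete_mulout // delete_mul1.
  rewrite delete_mul1 split_sign_sym // scaleNr addrN add0r.
  apply: big1 => L _; apply: big1 => G sp.
  have /andP[eL eG] := splits_notin eP sp; case/and4P: sp => L0 G0 _ _.
  rewrite -!block_mulE !linearZ /= delete_mulin ?setU11 ?setU1_neq1 //.
  rewrite delete_mulout // delete_mulin ?setU11 ?setU1_neq1 //.
  by rewrite !(linear0, scaler0) addr0.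
rewrite dwords_mul delete_mulout // IHw; congr (_ + _).
apply: eq_split_sum => L G sp; have /andP[eL eG] := splits_notin eB sp.
by rewrite -!block_mulE linearZ /= !delete_mulout // deleteE.
Qed.

Lemma delete_dwords x : delete (dwords x) = dwords (delete x).
Proof.
move: x; apply: is_linear_ext_uniq; linearity.
by move=> w; rewrite dwordsE deleteE delete_dword.
Qed.

Definition occurs w := has (fun B : {set X} => e \in B) w.

(** If [e] shares its block with [P], only the term [P {e}] of the differential is seen
    by the homotopy, which restores the word. If the first block [B] does not contain
    [e], the splittings of [e |: B] produce the commutator of [B] and [{e}], and all
    other terms cancel or are given by induction. *)
Lemma homotopy_word w : set0 \notin w -> occurs w ->
  dwords (absorb_word w) + absorb (dword w) = elt w - block_mul [set e] (delete_word w).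
Proof.
elim: w => [|B w IHw] //=; rewrite inE negb_or eq_sym => /andP[B0 w0].
have [eB _|eB /= ew] := boolP (e \in B).
  rewrite linear0 add0r linearD linearZ /= absorb_mulin // scaler0 addr0 raddf_split_sum /=.
  have [->|nB] := eqVneq B [set e]; first by rewrite split_sum1 block_mulE subrr.
  rewrite linear0 subr0.
  pose P := B :\ e; have eP : e \notin P by rewrite !inE eqxx.
  have EB : B = e |: P by rewrite setD1K.
  have P0 : P != set0 by apply: contra nB => /eqP P0; rewrite EB P0 setU0.
  rewrite EB split_sum_setU1 // -!block_mulE !linearZ /= absorb_mulout // delete_mul1.
  rewrite !absorb_mulin ?set11 // !(linear0, scaler0, addr0) scalerA split_sign2 scale1r.
  rewrite [X in _ + X](_ : _ = 0) ?addr0 //; apply: big1 => L _; apply: big1 => G sp.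
  have /andP[eL eG] := splits_notin eP sp; case/and4P: sp => L0 G0 _ _.
  rewrite -!block_mulE !linearZ /= absorb_mulin ?setU11 // scaler0 add0r.
  rewrite absorb_mulout // absorb_mulin ?setU11 // delete_mulin ?setU11 ?setU1_neq1 //.
  by rewrite !(linear0, scaler0, addr0).
case: eqP eB => [->|_ eB]; first by rewrite set11.
have {}IHw := IHw w0 ew.
pose y := delete_word w; pose h := absorb_word w.
have E1 : cs B [set e] *: split_sum (e |: B) (fun L G => cs L G *: block_mul L (block_mul G y)) =
    block_mul B (block_mul [set e] y) - block_mul [set e] (block_mul B y)
    + split_sum B (fun L G => (- (cs L G * cs L [set e])) *: block_mul (e |: L) (block_mul G y)
        + (- (sg L * (cs L G * cs G [set e]))) *: block_mul L (block_mul (e |: G) y)).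
  rewrite split_sum_setU1 // split_sign_sym // !scalerDr !scalerA mulrN split_sign2.
  rewrite scale1r scaleN1r.
  rewrite raddf_split_sum; congr (_ + _); apply: eq_split_sum => L G sp /=.
  have /andP[eL eG] := splits_notin eB sp; have /and4P[_ _ d /eqP E] := sp.
  by rewrite scalerDr !scalerA -{1 2}E split_sign_insl // split_sign_insr.
have E2 : sg B *: split_sum B (fun L G => cs L G *: block_mul L (block_mul G h)) =
    split_sum B (fun L G => (- (cs L G * (sg L * sg G))) *: block_mul L (block_mul G h)).
  rewrite raddf_split_sum; apply: eq_split_sum => L G /and4P[_ _ d /eqP E] /=.
  by rewrite scalerA -E block_signU // mulNr mulrC.
have E3 : split_sum B (fun L G => absorb (cs L G *: elt [:: L, G & w])) =
    split_sum B (fun L G => (cs L G * cs L [set e]) *: block_mul (e |: L) (block_mul G y)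
        + (sg L * (cs L G * cs G [set e])) *: block_mul L (block_mul (e |: G) y)
        + (cs L G * (sg L * sg G)) *: block_mul L (block_mul G h)).
  apply: eq_split_sum => L G sp; have /andP[eL eG] := splits_notin eB sp.
  rewrite -!block_mulE linearZ /= !absorb_mulout // delete_mulout // deleteE absorbE.
  rewrite !linearD !linearZ /= !scalerA addrA.
  congr (_ *: _ + _ *: _ + _ *: _); [exact: mulrC | | exact: mulrC].
  by rewrite -mulrA [cs G _ * _]mulrC.
rewrite !linearD !linearZ /= !dwords_mul raddf_split_sum /= absorb_mulout //.
rewrite -/y -/h E3 !scalerDr E1 E2 block_sign_setU1 // delete_dword -/y.
(* Grouped as: the commutator with the terms to which the induction hypothesis
   applies; the sums over splittings; the terms in the differential of y. *)
rewrite [LHS](AC ((3*2)*(1*2)) ((1*(5*8))*(2*4*6)*(3*7))) /=.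
rewrite !scalerA block_sign2 !scale1r mulrN scaleNr [sg B * _]mulrC addNr addr0.
rewrite -linearD IHw !split_sumD [X in _ + X](_ : _ = 0) ?addr0; last first.
  apply: big1 => L _; apply: big1 => G _; rewrite !scaleNr.
  by rewrite [LHS](AC ((2*1)*3) ((1*4)*(2*5)*(3*6))) /= !addNr !addr0.
by rewrite linearB /= block_mulE [LHS](AC (2*2) (3*2*(1*4))) /= subrr addr0.
Qed.

Lemma homotopy (P : word -> Prop) x :
  (forall w, P w -> set0 \notin w) -> (forall w, P w -> occurs w) -> spanned P x ->
  dwords (absorb x) + absorb (dwords x) = x - block_mul [set e] (delete x).
Proof.
move=> P0 Pe Px.
apply: (eq_spanned (f := fun x => dwords (absorb x) + absorb (dwords x))
  (h := fun x => x - block_mul [set e] (delete x)) Px); linearity.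
by move=> w Pw; rewrite dwordsE absorbE deleteE homotopy_word //; [exact: P0 | exact: Pe].
Qed.

End Contraction.
End Words.

(** * Exactness on ordered set partitions *)

Section Compositions.
Variables (k : fieldType) (X : finType).
Local Notation word := (seq {set X}).
Variable A : free_space k word.
Implicit Types (B C L G E : {set X}) (e : X) (w : word) (a x : A) (n : int).

Fixpoint composition E w : bool :=
  if w is B :: w' then [&& B != set0, B \subset E & composition (E :\: B) w'] else E == set0.

Fixpoint word_deg w : int := if w is B :: w' then (#|B| : int) - 1 + word_deg w' else 0.

Definition homog_composition E n w : bool := composition E w && (word_deg w == n).

Lemma composition_set0 E w : composition E w -> set0 \notin w.
Proof.
elim: w E => //= B w IHw E /and3P[B0 _ /IHw w0].
by rewrite inE negb_or eq_sym B0.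
Qed.

Lemma composition_occurs E e w : e \in E -> composition E w -> occurs e w.
Proof.
elim: w E => [|B w IHw] E /= eE; first by move/eqP => E0; rewrite E0 inE in eE.
case/and3P => _ _ Cw; case: (boolP (e \in B)) => //= eB.
by apply: IHw Cw; rewrite inE eB.
Qed.

Lemma spanned_block_mul E B n x : B != set0 -> B \subset E ->
  spanned (homog_composition (E :\: B) n) x ->
  spanned (homog_composition E (#|B|%:Z - 1 + n)) (block_mul A B x).
Proof.
move=> B0 BE Sx; apply: spanned_linear Sx _ => w /andP[Cw /eqP dw].
by rewrite block_mulE; apply: spanned_elt; rewrite /homog_composition /= B0 BE Cw dw eqxx.
Qed.

Lemma spanned_dword E n w : homog_composition E n w ->
  spanned (homog_composition E (n - 1)) (dword A w).
Proof.
elim: w E n => [|B w IHw] E n /=; first by move=> _; exact: spanned0.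
case/andP => /= /and3P[B0 BE Cw] /eqP <-; apply: spannedD; last first.
  apply: spannedZ; rewrite -addrA; apply: spanned_block_mul => //.
  by apply: IHw; rewrite /homog_composition Cw eqxx.
apply: spanned_sum => L _; apply: spanned_sum => G sp.
apply: spannedZ; apply: spanned_elt.
have cB := splits_card sp; have /and4P[L0 G0 d /eqP EB] := sp.
have LE : L \subset E by apply: subset_trans BE; rewrite -EB subsetUl.
have GE : G \subset E :\: L.
  by rewrite subsetD disjoint_sym d andbT; apply: subset_trans BE; rewrite -EB subsetUr.
rewrite /homog_composition; apply/andP; split; last by apply/eqP; rewrite /= cB; lia.
by apply/and3P; split => //; apply/and3P; split => //; rewrite setDDl EB.
Qed.

Lemma spanned_delete E n e w : e \in E -> homog_composition E n w ->
  spanned (homog_composition (E :\ e) n) (delete_word A e w).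
Proof.
elim: w E n => [|B w IHw] E n /= eE; first by move=> _; exact: spanned0.
case/andP => /= /and3P[B0 BE Cw] /eqP <-.
have [EB|nB] := eqVneq B [set e].
  by apply: spanned_elt; rewrite EB in Cw *; rewrite cards1 subrr add0r /homog_composition Cw eqxx.
have [eB|eB] := boolP (e \in B); first exact: spanned0.
apply: spanned_block_mul => //; first by rewrite subsetD1 BE.
rewrite setDDl setUC -setDDl; apply: IHw; first by rewrite inE eB.
by rewrite /homog_composition Cw eqxx.
Qed.

Lemma spanned_absorb E n e w : e \in E -> homog_composition E n w ->
  spanned (homog_composition E (n + 1)) (absorb_word A e w).
Proof.
elim: w E n => [|B w IHw] E n /= eE; first by move=> _; exact: spanned0.
case/andP => /= /and3P[B0 BE Cw] /eqP <-.
have [eB|eB] := boolP (e \in B); first exact: spanned0.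
have eEB : e \in E :\: B by rewrite inE eB.
have Hw : homog_composition (E :\: B) (word_deg w) w by rewrite /homog_composition Cw eqxx.
apply: spannedD; apply: spannedZ.
  rewrite (_ : _ + 1 = #|e |: B|%:Z - 1 + word_deg w); last by rewrite cardsU1 eB; lia.
  apply: spanned_block_mul; first by apply/set0Pn; exists e; rewrite setU11.
    by rewrite subUset sub1set eE.
  by rewrite setUC -setDDl; exact: spanned_delete.
by rewrite -addrA; apply: spanned_block_mul => //; exact: IHw.
Qed.

Definition singletons w : bool := all (fun B : {set X} => #|B| == 1%N) w.
Definition augment : {linear A -> k^o} := ext (fun w => (singletons w)%:R : k^o).

Lemma augmentE w : augment (elt w) = (singletons w)%:R.
Proof. exact: extE. Qed.

Lemma augment_block_mul B x : augment (block_mul A B x) = (#|B| == 1%N)%:R * augment x.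
Proof.
move: x; apply: is_linear_ext_uniq.
- linearity.
- by move=> c u v; rewrite linearP /= mulrDr -!/(_ *: _) /GRing.scale /= mulrCA.
- by move=> w; rewrite block_mulE !augmentE /=; case: (_ == _); rewrite ?mul1r ?mul0r.
Qed.

Lemma augment_delete e w : occurs e w -> augment (delete_word A e w) = augment (elt w).
Proof.
elim: w => [|B w IHw] //=; have [->|nB] := eqVneq B [set e].
  by rewrite !augmentE /= cards1 eqxx.
have [eB _|eB /= /IHw E] := boolP (e \in B).
  rewrite linear0 augmentE /=; case: eqP => //= /eqP/cards1P[y EB].
  by move: eB nB; rewrite EB inE => /eqP ->; rewrite eqxx.
by rewrite augment_block_mul E -augment_block_mul block_mulE.
Qed.

(** Deletion preserves the augmentation and commutes with the differential, so that
    the claim descends to smaller sets. *)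
Lemma augment_dword E w : composition E w -> augment (dword A w) = 0.
Proof.
move: {2}(#|E|) (erefl #|E|) => m; elim: m E w => [|m IHm] E w.
  move/eqP; rewrite cards_eq0 => /eqP -> {E}; case: w => [|B w] /=; first by rewrite linear0.
  by rewrite subset0; case: (B == set0).
move=> cE Cw; have /card_gt0P[e eE] : (0 < #|E|)%N by rewrite cE.
have Sd : spanned (homog_composition E (word_deg w - 1)) (dword A w).
  by apply: spanned_dword; rewrite /homog_composition Cw eqxx.
rewrite (eq_spanned (h := fun x => augment (delete A e x)) Sd); first last.
- by move=> v /andP[Cv _]; rewrite deleteE augment_delete //; exact: composition_occurs Cv.
- linearity.
- linearity.
rewrite delete_dword.
have Sw : spanned (homog_composition (E :\ e) (word_deg w)) (delete_word A e w).
  by apply: spanned_delete => //; rewrite /homog_composition Cw eqxx.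
rewrite (eq_spanned (f := fun x => augment (dwords A x)) (h := fun=> 0) Sw) //; try linearity.
move=> v /andP[Cv _]; rewrite dwordsE; apply: IHm Cv.
by move: (cardsD1 e E); rewrite eE cE => -[].
Qed.

(** The augmented cellular complex of the permutohedron is exact. A cycle [a] is
    homologous to [{e}] times the deletion of [e] in [a], which is a cycle on a smaller
    set with the same augmentation. *)
Lemma composition_exact E n a : spanned (homog_composition E n) a ->
  dwords A a = 0 -> augment a = 0 ->
  exists2 b, spanned (homog_composition E (n + 1)) b & dwords A b = a.
Proof.
move: {2}(#|E|) (erefl #|E|) => m; elim: m E a => [|m IHm] E a.
  move/eqP; rewrite cards_eq0 => /eqP -> {E} Sa _ aug0.
  exists 0; first exact: spanned0.
  rewrite linear0 (eq_spanned (f := id) (h := fun x => (augment x : k) *: (elt [::] : A)) Sa).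
  - by rewrite aug0 scale0r.
  - by [].
  - by move=> c u v; rewrite linearP scalerDl scalerA.
  case=> [|B w] /andP[/=]; first by rewrite augmentE scale1r.
  by rewrite subset0; case: (B == set0).
move=> cE Sa da aug0; have /card_gt0P[e eE] : (0 < #|E|)%N by rewrite cE.
have Sda : spanned (homog_composition (E :\ e) n) (delete A e a).
  by apply: spanned_linear Sa _ => w Hw; rewrite deleteE; exact: spanned_delete.
have [|||b Sb db] := IHm (E :\ e) _ _ Sda; first by move: (cardsD1 e E); rewrite eE cE => -[].
- by rewrite -delete_dwords da linear0.
- rewrite -aug0; apply: (eq_spanned (f := fun x => augment (delete A e x)) (h := augment) Sa).
  + linearity.
  + linearity.
  + by move=> w /andP[Cw _]; rewrite deleteE augment_delete //; exact: composition_occurs Cw.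
exists (absorb A e a + block_mul A [set e] b).
  apply: spannedD.
    by apply: spanned_linear Sa _ => w Hw; rewrite absorbE; exact: spanned_absorb.
  rewrite (_ : n + 1 = #|[set e]|%:Z - 1 + (n + 1)); last by rewrite cards1; lia.
  apply: spanned_block_mul => //; last by rewrite sub1set.
  by apply/set0Pn; exists e; rewrite set11.
have := homotopy (e := e) _ _ Sa; rewrite da linear0 addr0 linearD dwords_mul => ->.
- by rewrite split_sum1 add0r block_sign1 scale1r db subrK.
- by move=> w /andP[Cw _]; exact: composition_set0 Cw.
- by move=> w /andP[Cw _]; exact: composition_occurs Cw.
Qed.

End Compositions.

(** * Shuffles and splittings *)

Section Inversions.
Variable n : nat.
Implicit Types (s t : 'S_n) (i j : 'I_n) (p : nat).

(** Permuting the columns of a Vandermonde matrix multiplies its determinant by the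
    signature; as the determinant is a product of differences, its sign counts the
    inversions. *)
Lemma odd_perm_inversions s :
  odd_perm s = odd (\sum_(i : 'I_n) \sum_(j : 'I_n | (i < j)%N) (s j < s i))%N.
Proof.
pose a := \row_i ((i : nat)%:Z : int) : 'rV[int]_n.
pose b := \row_i ((s i : nat)%:Z : int) : 'rV[int]_n.
have EV : Vandermonde n b = col_perm s (Vandermonde n a).
  by apply/matrixP => i j; rewrite !mxE.
have : \det (Vandermonde n b) = (-1) ^+ s * \det (Vandermonde n a).
  by rewrite EV col_permE det_mulmx det_perm odd_permV mulrC.
have sgP (c : 'I_n -> nat) : injective c ->
    Num.sg (\prod_(i < n) \prod_(j < n | (i < j)%N) ((c j)%:Z - (c i)%:Z)) =
    (-1) ^+ (\sum_(i : 'I_n) \sum_(j : 'I_n | (i < j)%N) (c j < c i))%N.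
  move=> ci; rewrite (big_morph Num.sg (@sgrM _) (@sgr1 _)) expr_sum; apply: eq_bigr => i _.
  rewrite (big_morph Num.sg (@sgrM _) (@sgr1 _)) expr_sum; apply: eq_bigr => j ij.
  case: (ltngtP (c j) (c i)) => [lt|lt|/ci E].
  - by rewrite ltr0_sg ?expr1 // subr_lt0 ltz_nat.
  - by rewrite gtr0_sg ?expr0 // subr_gt0 ltz_nat.
  - by rewrite E ltnn in ij.
move/(congr1 Num.sg); rewrite sgrM !det_Vandermonde.
under eq_bigr => i _ do under eq_bigr => j _ do rewrite !mxE.
under [X in _ = _ * Num.sg X]eq_bigr => i _ do under eq_bigr => j _ do rewrite !mxE.
rewrite (sgP (fun i => s i : nat)); last by move=> i j /ord_inj/perm_inj.
rewrite (sgP (fun i => i : nat)); last by move=> i j /ord_inj.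
rewrite [X in _ * (-1) ^+ X]big1 => [|i _]; last first.
  by apply: big1 => j; case: ltngtP.
rewrite mulr1 sgrX sgrN1 -signr_odd => /eqP.
by case: odd; case: (odd_perm s).
Qed.

Definition low p : {set 'I_n} := [set i : 'I_n | (i < p)%N].

Lemma card_low p : (p <= n)%N -> #|low p| = p.
Proof.
move=> pn; have -> : low p = [set widen_ord pn i | i in [set: 'I_p]].
  apply/setP => i; rewrite inE; apply/idP/imsetP => [ip|[j _ ->]] //=.
  by exists (Ordinal ip); [rewrite inE | exact: ord_inj].
rewrite card_imset ?cardsT ?card_ord // => i j E; apply: ord_inj.
by move: (congr1 val E).
Qed.

Lemma sorted_filter_ord (P : pred 'I_n) :
  sorted (fun i j : 'I_n => (i < j)%N) [seq i <- enum 'I_n | P i].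
Proof.
apply: sorted_filter; first by move=> a b c; exact: ltn_trans.
have := iota_ltn_sorted 0 n; by rewrite -val_enum_ord sorted_map.
Qed.

Lemma shuffle_incr p s i j : is_shuffle p s -> (i < j)%N ->
  ((j < p) || (p <= i))%N -> (s i < s j)%N.
Proof.
by move=> /forallP/(_ i)/forallP/(_ j)/implyP sh ij ijp; apply: sh; rewrite ij.
Qed.

Let eq_on_filter p s t (P : pred 'I_n) : is_shuffle p s -> is_shuffle p t ->
  (forall i j, P i -> P j -> (j < p) || (p <= i))%N ->
  s @: [set i | P i] = t @: [set i | P i] -> {in P, s =1 t}.
Proof.
move=> shs sht PP E i Pi.
have sor u : is_shuffle p u ->
    sorted (fun i j : 'I_n => (i < j)%N) [seq u i | i <- [seq i <- enum 'I_n | P i]].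
  move=> shu; apply: (homo_sorted_in (P := P)) (sorted_filter_ord P) => [a b Pa Pb ab|].
    exact: shuffle_incr shu ab (PP a b Pa Pb).
  exact: filter_all.
have mem u : [seq u i | i <- [seq i <- enum 'I_n | P i]] =i u @: [set i | P i].
  move=> y; apply/mapP/imsetP => -[x]; rewrite ?mem_filter ?inE.
    by case/andP => Px _ ->; exists x; rewrite ?inE.
  by move=> Px ->; exists x; rewrite // mem_filter Px mem_enum.
have /eq_in_map : [seq s i | i <- [seq i <- enum 'I_n | P i]] =
    [seq t i | i <- [seq i <- enum 'I_n | P i]].
  apply: (irr_sorted_eq (leT := fun i j : 'I_n => (i < j)%N)).
  - by move=> a b c; exact: ltn_trans.
  - by move=> a; exact: ltnn.
  - exact: sor.
  - exact: sor.
  - by move=> y; rewrite !mem E.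
by apply; rewrite mem_filter mem_enum andbT; exact: Pi.
Qed.

(** A shuffle increases on each of its two ranges, so it is determined by the image of
    the first. *)
Lemma shuffle_inj p s t : is_shuffle p s -> is_shuffle p t ->
  s @: low p = t @: low p -> s = t.
Proof.
move=> shs sht E; apply/perm.permP => i.
case: (ltnP i p) => ip.
  apply: (eq_on_filter (p := p) (P := fun i : 'I_n => (i < p)%N)) => //.
  by move=> a b _ ->.
apply: (eq_on_filter (p := p) (P := fun i : 'I_n => (p <= i)%N)) => //.
  by move=> a b -> _; rewrite orbT.
have C (u : {perm 'I_n}) : u @: [set i : 'I_n | (p <= i)%N] = ~: (u @: low p).
  apply/setP => y; rewrite inE -[y](permKV u) !(mem_imset _ _ (@perm_inj _ u)) !inE.
  by rewrite -leqNgt.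
by rewrite !C E.
Qed.

(** The shuffle enumerates [S] in increasing order, and then its complement. *)
Lemma shuffle_exists (S : {set 'I_n}) : exists2 s : 'S_n, is_shuffle #|S| s & s @: low #|S| = S.
Proof.
pose r1 := [seq i <- enum 'I_n | i \in S]; pose r2 := [seq i <- enum 'I_n | i \notin S].
have s1 : size r1 = #|S| by rewrite cardE /enum_mem -enumT; congr (size _); apply: eq_filter.
have pr : perm_eq (r1 ++ r2) (enum 'I_n).
  by apply/permPl; exact: (perm_filterC (mem S)).
have sz : size (r1 ++ r2) = n by rewrite (perm_size pr) size_enum_ord.
have ur : uniq (r1 ++ r2) by rewrite (perm_uniq pr) enum_uniq.
pose f i := nth i (r1 ++ r2) i.
have fE i0 (i : 'I_n) : f i = nth i0 (r1 ++ r2) i by apply: set_nth_default; rewrite sz.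
have finj : injective f.
  move=> i j; rewrite (fE i i) (fE i j) => /eqP; rewrite nth_uniq ?sz //.
  by move=> /eqP/ord_inj.
have tr : transitive (fun i j : 'I_n => (i < j)%N) by move=> a b c; exact: ltn_trans.
exists (perm finj).
  apply/forallP => i; apply/forallP => j; apply/implyP => /andP[ij ijp]; rewrite !permE.
  rewrite (fE i i) (fE i j) !nth_cat s1.
  case: (ltnP j #|S|) ijp => jS /= ijp.
    rewrite (ltn_trans ij jS).
    apply: (sorted_ltn_nth tr i (sorted_filter_ord (mem S)) _ _ _ _ ij); rewrite inE -/r1 s1 //.
    exact: ltn_trans ij jS.
  rewrite [(i < #|S|)%N]ltnNge ijp /=.
  have lt2 (a : 'I_n) : (#|S| <= a)%N -> (a - #|S| < size r2)%N.
    by move=> aS; rewrite ltn_subLR // -s1 -size_cat sz.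
  apply: (sorted_ltn_nth tr i (sorted_filter_ord (fun i => i \notin S)));
    by rewrite ?inE -/r2 ?lt2 ?ltn_sub2r // (leq_ltn_trans ijp ij).
apply/eqP; rewrite eqEcard; apply/andP; split.
  apply/subsetP => y /imsetP[i]; rewrite inE => iS ->; rewrite permE (fE i i) nth_cat s1 iS.
  have : nth i r1 i \in r1 by rewrite mem_nth // s1.
  by rewrite mem_filter => /andP[].
rewrite card_imset ?card_low //; last exact: perm_inj.
by rewrite -[n in (_ <= n)%N]card_ord max_card.
Qed.

End Inversions.

Lemma enum_val_rank (Y : finType) (E : {set Y}) (i j : 'I_#|E|) :
  (enum_rank (enum_val i) < enum_rank (enum_val j))%N = (i < j)%N.
Proof.
pose lt (x y : Y) := (enum_rank x < enum_rank y)%N.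
have tr : transitive lt by move=> a b c; exact: ltn_trans.
pose x0 := enum_val i.
have rk (m : nat) : (m < size (enum Y))%N -> enum_rank (nth x0 (enum Y) m) = m :> nat.
  rewrite -cardE => mY; rewrite (_ : nth _ _ _ = enum_val (Ordinal mY)) ?enum_valK //.
  exact: (esym (enum_val_nth x0 (Ordinal mY))).
have so : sorted lt (enum E).
  rewrite /enum_mem; apply: sorted_filter => //.
  rewrite -enumT; apply/(sortedP x0) => m mY.
  by rewrite /lt !rk // ltnW.
have lt_mono (a b : 'I_#|E|) : (a < b)%N -> lt (enum_val a) (enum_val b).
  move=> ab; rewrite !(enum_val_nth x0).
  by apply: (sorted_ltn_nth tr x0 so _ _ _ _ ab); rewrite inE -cardE.
case: (ltngtP i j) => [|/lt_mono|/ord_inj->]; [exact: lt_mono | | exact: ltnn].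
by move=> /ltnW; rewrite leqNgt => /negbTE.
Qed.

Section ShuffleSum.
Variables (I : finType) (E : {set {set I}}).
Implicit Types (s : 'S_#|E|) (p : nat).

Lemma edge_at_inj : injective (@edge_at I E).
Proof. exact: enum_val_inj. Qed.

Lemma shuffle_leftE_low p s : shuffle_left p s = @edge_at I E @: (s @: low _ p).
Proof. by rewrite -imset_comp; apply: eq_imset. Qed.

Lemma shuffle_rightE p s : shuffle_right p s = E :\: shuffle_left p s.
Proof.
rewrite shuffle_leftE setDDr setDv set0U; apply/esym/setIidPr.
exact: shuffle_right_sub.
Qed.

(** An inversion of a shuffle is a pair of edges, the greater one in the left factor. *)
Lemma odd_shuffle p s : is_shuffle p s ->
  odd_perm s = odd (inversions (shuffle_left p s) (shuffle_right p s)).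
Proof.
move=> sh; rewrite odd_perm_inversions; congr odd.
have inj : injective (fun i => edge_at (s i)) by move=> i j /edge_at_inj/perm_inj.
rewrite /inversions /shuffle_left big_imset /=; last by move=> i j _ _; exact: inj.
rewrite (bigID (fun i : 'I__ => (i < p)%N)) /= [X in (_ + X)%N]big1 ?addn0; last first.
  move=> i; rewrite -leqNgt => pi; apply: big1 => j ij.
  by rewrite ltnNge ltnW // (shuffle_incr sh) // pi orbT.
rewrite [RHS](eq_bigl (fun i : 'I__ => (i < p)%N)); last by move=> i; rewrite inE.
apply: eq_bigr => i ip; rewrite /shuffle_right big_imset /=; last by move=> a b _ _; exact: inj.
rewrite (bigID (fun j : 'I__ => (p <= j)%N)) /= [X in (_ + X)%N]big1 ?addn0; last first.
  move=> j /andP[ij]; rewrite -ltnNge => jp.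
  by rewrite ltnNge ltnW // (shuffle_incr sh) // jp.
apply: eq_big => [j|j _]; last by rewrite enum_val_rank.
by rewrite inE andbC; case: (leqP p j) => //= pj; rewrite (leq_trans ip pj).
Qed.

(** A p-shuffle is the same thing as a choice of the p edges of the left factor, and its
    signature is the parity of the inversions between the two factors. *)
Lemma sum_shuffles (k : fieldType) (V : lmodType k) (f : {set {set I}} -> {set {set I}} -> V) :
  \sum_(1 <= p < #|E|) \sum_(s : 'S_#|E| | is_shuffle p s)
    (-1) ^+ odd_perm s *: f (shuffle_left p s) (shuffle_right p s)
  = split_sum E (fun L G => (-1) ^+ inversions L G *: f L G).
Proof.
pose F L : V := (-1) ^+ inversions L (E :\: L) *: f L (E :\: L).
have step p : (0 < p < #|E|)%N -> \sum_(s : 'S_#|E| | is_shuffle p s)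
    (-1) ^+ odd_perm s *: f (shuffle_left p s) (shuffle_right p s) =
    \sum_(L : {set {set I}} | (L \subset E) && (#|L| == p)) F L.
  case/andP => p0 pn.
  (* The choice inverts [shuffle_left p] on the sets of p edges; its default value at
     any other set L fails the test [shuffle_left p s == L]. *)
  rewrite (reindex_onto
    (fun L => odflt 1%g [pick s : 'S_#|E| | is_shuffle p s && (shuffle_left p s == L)])
    (fun s => shuffle_left p s)) /=; last first.
    move=> s sh; case: pickP => [t /andP[sht /eqP Et]|/(_ s)]; last by rewrite sh eqxx.
    apply: shuffle_inj sht sh _; apply: (imset_inj edge_at_inj).
    by rewrite -!shuffle_leftE_low.
  apply: eq_big => [L|L]; last first.
    case/andP => sh /eqP EL; rewrite (odd_shuffle sh) shuffle_rightE EL.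
    by rewrite signr_odd.
  apply/idP/idP.
    case/andP => _ /eqP <-; rewrite shuffle_leftE subsetDl /=.
    rewrite -shuffle_leftE shuffle_leftE_low !card_imset ?card_low ?(ltnW pn) //.
      exact: perm_inj.
    exact: edge_at_inj.
  case/andP => LE /eqP Lp.
  have [s sh Es] := shuffle_exists [set i : 'I_#|E| | edge_at i \in L].
  have Sp : #|[set i : 'I_#|E| | edge_at i \in L]| = p.
    rewrite -Lp -(card_imset _ edge_at_inj); congr #|pred_of_set _|.
    apply/setP => X; apply/imsetP/idP => [[i]|XL]; first by rewrite inE => iL ->.
    have XE := subsetP LE X XL; exists (enum_rank_in XE X).
      by rewrite inE /edge_at enum_rankK_in.
    by rewrite /edge_at enum_rankK_in.
  have EL : shuffle_left p s = L.
    rewrite shuffle_leftE_low -Sp Es.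
    apply/setP => X; apply/imsetP/idP => [[i]|XL]; first by rewrite inE => iL ->.
    have XE := subsetP LE X XL; exists (enum_rank_in XE X).
      by rewrite inE /edge_at enum_rankK_in.
    by rewrite /edge_at enum_rankK_in.
  rewrite Sp in sh; case: pickP => [t /andP[-> ->] //|/(_ s)].
  by rewrite sh EL eqxx.
rewrite (eq_big_nat _ _ step) split_sumE.
rewrite (exchange_big_dep xpredT) //= [RHS]big_mkcond; apply: eq_bigr => L _.
case: and3P => [[LE L0 LnE]|nL]; last first.
  rewrite big_nat_cond big1 // => p /andP[/andP[p0 pn] /andP[LE /eqP Lp]]; case: nL; split => //.
    by rewrite -cards_eq0 Lp -lt0n.
  by apply: contraTneq pn => <-; rewrite Lp ltnn.
have Ln : (#|L| < #|E|)%N by rewrite proper_card // properEneq LnE.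
rewrite big_mkcond /= (bigD1_seq #|L|) ?iota_uniq ?mem_index_iota ?card_gt0 ?L0 //=.
rewrite LE eqxx big1 ?addr0 // => p pL.
by rewrite eq_sym (negbTE pL).
Qed.

End ShuffleSum.

(** * Graded categories with a basis of morphisms *)

Section BasisGrading.
Variables (k : fieldType) (B : choiceType) (deg : B -> int).
Implicit Types (f v : {malg k[B]}) (n : int).

Lemma eq_supported (P : B -> Prop) (V : lmodType k) (F H : {malg k[B]} -> V) v :
  supported P v -> is_linear F -> is_linear H ->
  (forall b, P b -> F << b >> = H << b >>) -> F v = H v.
Proof.
move=> Pv Fl Hl E.
pose F' : {linear {malg k[B]} -> V} := HB.pack F (GRing.isLinear.Build k _ V *:%R F Fl).
pose H' : {linear {malg k[B]} -> V} := HB.pack H (GRing.isLinear.Build k _ V *:%R H Hl).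
by apply: (@eq_linear k B V F' H') => b /Pv/E.
Qed.

Lemma malg_grading : is_grading (fun n v => forall b, b \in msupp v -> deg b = n).
Proof.
split.
- by move=> n b; rewrite msupp0.
- move=> n a u v Pu Pv; pose P b := deg b = n.
  exact: (@supportedD k B P _ _ (@supportedZ k B P a u Pu) Pv).
- move=> v; pose c n := mlin (fun b => if deg b == n then << b >> else 0 : {malg k[B]}) v.
  exists (undup [seq deg b | b <- msupp v]), c; split.
    move=> n; apply: (@supported_mlin k B (fun b => deg b = n) B (fun=> True)) => // b _.
    case: eqP => [E|_]; [exact: supportedU | exact: supported0].
  rewrite {1}[v]malg_sum /c /mlin exchange_big /= big_seq [RHS]big_seq.
  apply: eq_bigr => b bv; rewrite -scaler_sumr; congr (_ *: _).
  rewrite (bigD1_seq (deg b)) ?undup_uniq ?mem_undup ?map_f //= eqxx big1 ?addr0 //.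
  by move=> n nb; rewrite eq_sym (negbTE nb).
- move=> r c ur Pc s0 n nr; apply/malgP => b; rewrite mcoeff0.
  case: (msuppP (c n) b) => // bn.
  have /(congr1 (mcoeff b)) := s0; rewrite raddf_sum mcoeff0 /= (bigD1_seq n) //= big1 ?addr0 //.
  move=> m mn; apply: mcoeff_outdom; apply: contra mn => bm.
  by rewrite -(Pc _ _ bm) (Pc _ _ bn).
Qed.

End BasisGrading.

Section LinearizedCategory.
Variables (k : fieldType) (O : Type) (M : O -> O -> choiceType).
Variables (deg : forall t s, M t s -> int) (one : forall t, M t t).
Variable mul : forall t x s, M x s -> M t x -> M t s.

(** Both the free category and the linearized tree category are, by definition,
    instances of this one: composition extends bilinearly a composition of basis
    morphisms. *)
Definition linearization : gcat k O :=
  @GCat k O (fun t s => {malg k[M t s]} : lmodType k)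
    (fun t s n (f : {malg k[M t s]}) => forall p, p \in msupp f -> deg p = n)
    (fun t => << one t >>)
    (fun t x s (f : {malg k[M x s]}) (g : {malg k[M t x]}) =>
       mlin (fun p => mlin (fun q => << mul p q >> : {malg k[M t s]}) g) f).

Lemma is_linear_param (V U : lmodType k) (B : choiceType) (F : B -> V -> U) (f : {malg k[B]}) :
  (forall b, is_linear (F b)) -> is_linear (fun v => mlin (fun b => F b v) f).
Proof. by move=> Fl; apply: is_linear_sum => b; apply: is_linearZ. Qed.

Lemma linearization_compl t x s (g : hom linearization t x) :
  is_linear (fun f : hom linearization x s => comp f g).
Proof. exact: mlin_is_linear. Qed.

Lemma linearization_compr t x s (f : hom linearization x s) :
  is_linear (fun g : hom linearization t x => comp f g).
Proof. by apply: is_linear_param => p; exact: mlin_is_linear. Qed.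

Lemma linearization_compU t x s (p : M x s) (q : M t x) :
  comp (<< p >> : hom linearization x s) (<< q >> : hom linearization t x) = << mul p q >>.
Proof. by rewrite /= !mlinU. Qed.

Hypotheses (mulA : forall t x y s (f : M y s) (g : M x y) (h : M t x),
              mul f (mul g h) = mul (mul f g) h)
  (mul1l : forall t s (f : M t s), mul (one s) f = f)
  (mul1r : forall t s (f : M t s), mul f (one t) = f)
  (deg1 : forall t, deg (one t) = 0)
  (degM : forall t x s (f : M x s) (g : M t x), deg (mul f g) = deg f + deg g).

Lemma linearization_is_gcat : is_gcat linearization.
Proof.
split.
- by move=> t s; exact: malg_grading.
- by move=> t x s g; exact: linearization_compl.
- by move=> t x s f; exact: linearization_compr.
- move=> t x y s f g h.
  have cl := linearization_compl; have cr := linearization_compr.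
  apply: (is_linear_eq (f := fun f : {malg k[M y s]} => @comp k O linearization _ _ _ f (comp g h))
    (h := fun f => @comp k O linearization _ _ _ (@comp k O linearization _ _ _ f g) h)).
  + exact: cl.
  + by apply: (is_linear_comp (cl _ _ _ h)); exact: cl.
  move=> p.
  apply: (is_linear_eq (f := fun g : {malg k[M x y]} =>
    @comp k O linearization _ _ _ << p >> (@comp k O linearization _ _ _ g h))
    (h := fun g => @comp k O linearization _ _ _ (@comp k O linearization _ _ _ << p >> g) h)).
  + by apply: (is_linear_comp (cr _ _ _ _)); exact: cl.
  + by apply: (is_linear_comp (cl _ _ _ h)); exact: cr.
  move=> q.
  apply: (is_linear_eq (f := fun h : {malg k[M t x]} =>
    @comp k O linearization _ _ _ << p >> (@comp k O linearization _ _ _ << q >> h))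
    (h := fun h => @comp k O linearization _ _ _
      (@comp k O linearization _ _ _ << p >> << q >>) h)).
  + by apply: (is_linear_comp (cr _ _ _ _)); exact: cr.
  + exact: cr.
  by move=> r; rewrite !linearization_compU mulA.
- move=> t s; apply: (is_linear_eq (f := fun f : {malg k[M t s]} =>
    @comp k O linearization _ _ _ << one s >> f) (h := id)) => //.
    exact: linearization_compr.
  by move=> p; rewrite linearization_compU mul1l.
- move=> t s; apply: (is_linear_eq (f := fun f : {malg k[M t s]} =>
    @comp k O linearization _ _ _ f << one t >>) (h := id)) => //.
    exact: linearization_compl.
  by move=> p; rewrite linearization_compU mul1r.
- by move=> t p /(supportedU (k := k) (P := fun p => p = one t) (erefl _)) ->.
- move=> t x s f g m n Hf Hg.
  apply: (supported_mlin (P := fun p => deg p = m + n) (Q := fun p => deg p = m)) Hf => p dp.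
  apply: (supported_mlin (P := fun p => deg p = m + n) (Q := fun p => deg p = n)) Hg => q dq.
  by apply: supportedU; rewrite degM dp dq.
Qed.

End LinearizedCategory.

(** * The free graded category *)

(** The Leibniz rule on paths follows from the axioms of a category and from the
    recursive definition [dp_cons] of the derivation alone. *)
Section LeibnizPath.
Variables (k : fieldType) (O : choiceType) (G : bgraph O) (C : gcat k O).
Hypothesis HC : is_gcat C.
Variable elt : forall t s, gpath (basis G) t s -> hom C t s.
Hypothesis elt1 : forall t, elt gnil = idm t :> hom C t t.
Hypothesis eltM : forall t x s (p : gpath (basis G) x s) (q : gpath (basis G) t x),
  elt (gcat_path p q) = comp (elt p) (elt q).
Variable d : forall t s, basis G t s -> hom C t s.
Variable dp : forall t s, gpath (basis G) t s -> hom C t s.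
Hypothesis dp_nil : forall t, dp gnil = 0 :> hom C t t.
Hypothesis dp_cons : forall t x s (b : basis G x s) (q : gpath (basis G) t x),
  dp (gcons b q) = comp (d b) (elt q) + (-1) ^ bdeg b *: comp (elt (gcons b gnil)) (dp q).

Lemma gcat_comp0l t x s (g : hom C t x) : comp (0 : hom C x s) g = 0.
Proof.
have := comp_linl HC g 1 (0 : hom C x s) 0; rewrite /= !scale1r addr0 => E.
by apply: (addrI (comp 0 g)); rewrite addr0 -E.
Qed.

Lemma gcat_comp0r t x s (f : hom C x s) : comp f (0 : hom C t x) = 0.
Proof.
have := comp_linr HC f 1 (0 : hom C t x) 0; rewrite /= !scale1r addr0 => E.
by apply: (addrI (comp f 0)); rewrite addr0 -E.
Qed.

Lemma gcat_compZr t x s (f : hom C x s) (g : hom C t x) (c : k) : comp f (c *: g) = c *: comp f g.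
Proof. by have := comp_linr HC f c g 0; rewrite !addr0 gcat_comp0r addr0. Qed.

Lemma gcat_compZl t x s (f : hom C x s) (g : hom C t x) (c : k) : comp (c *: f) g = c *: comp f g.
Proof. by have := comp_linl HC g c f 0; rewrite !addr0 gcat_comp0l addr0. Qed.

Lemma gcat_compDl t x s (f f' : hom C x s) (g : hom C t x) : comp (f + f') g = comp f g + comp f' g.
Proof. by have := comp_linl HC g 1 f f'; rewrite !scale1r. Qed.

Lemma gcat_compDr t x s (f : hom C x s) (g g' : hom C t x) : comp f (g + g') = comp f g + comp f g'.
Proof. by have := comp_linr HC f 1 g g'; rewrite !scale1r. Qed.

Lemma leibniz_path t x s (p : gpath (basis G) x s) (q : gpath (basis G) t x) :
  dp (gcat_path p q) = comp (dp p) (elt q) + (-1) ^ path_deg p *: comp (elt p) (dp q).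
Proof.
elim: p q => [q|y w b p IHp q] /=.
  by rewrite dp_nil elt1 gcat_comp0l add0r expr0z scale1r (comp_idl HC).
rewrite !dp_cons IHp gcat_compDr gcat_compZr gcat_compDl gcat_compZl eltM.
rewrite (eltM (gcons b gnil) p : elt (gcons b p) = _) !(comp_assoc HC) scalerDr scalerA -addrA.
by rewrite -expfzDr ?oppr_eq0 ?oner_eq0.
Qed.

End LeibnizPath.

Section FreeCategory.
Variables (k : fieldType) (O : choiceType) (G : bgraph O).
Local Notation C := (free_cat k G).
Local Notation elt := (@path_elt k O G _ _).

Lemma gcat_path_nil t s (p : gpath (basis G) t s) : gcat_path p gnil = p.
Proof. by elim: p => //= x y b q ->. Qed.

Lemma gcat_pathA t x y s (p : gpath (basis G) y s) (q : gpath (basis G) x y)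
    (r : gpath (basis G) t x) : gcat_path p (gcat_path q r) = gcat_path (gcat_path p q) r.
Proof. by elim: p q => //= z w b p IHp q; rewrite IHp. Qed.

Lemma path_deg_cat t x s (p : gpath (basis G) x s) (q : gpath (basis G) t x) :
  path_deg (gcat_path p q) = path_deg p + path_deg q.
Proof. by elim: p q => [q|y w b p IHp q] /=; rewrite ?add0r // IHp addrA. Qed.

Lemma free_cat_is_gcat : is_gcat C.
Proof.
exact: (@linearization_is_gcat k O (fun t s => gpath (basis G) t s)
  (fun t s p => path_deg p) (fun t => gnil) (fun t x s p q => gcat_path p q)
  (fun t x y s p q r => gcat_pathA p q r) (fun t s p => erefl p) (fun t s p => gcat_path_nil p)
  (fun t => erefl) (fun t x s p q => path_deg_cat p q)).
Qed.

Let HC := free_cat_is_gcat.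

Lemma comp_elt t x s (p : gpath (basis G) x s) (q : gpath (basis G) t x) :
  comp (elt p) (elt q) = elt (gcat_path p q).
Proof. by rewrite /path_elt /= !mlinU. Qed.

Section Derivation.
Variable d : forall t s, basis G t s -> hom C t s.

Lemma derivation_is_linear t s : is_linear (fun f : hom C t s => derivation d f).
Proof. exact: mlin_is_linear. Qed.

Lemma derivation_elt t s (p : gpath (basis G) t s) : derivation d (elt p) = derivation_path d p.
Proof. by rewrite /derivation /path_elt mlinU. Qed.

Lemma derivation_path_cat t x s (p : gpath (basis G) x s) (q : gpath (basis G) t x) :
  derivation_path d (gcat_path p q) =
  comp (derivation_path d p) (elt q) + (-1) ^ path_deg p *: comp (elt p) (derivation_path d q).
Proof.
exact: (@leibniz_path k O G C HC (fun t s p => elt p) (fun t => erefl)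
  (fun t x s p q => esym (comp_elt p q)) (fun t s b => d b)
  (fun t s p => derivation_path d p) (fun t => erefl) (fun t x s b q => erefl)).
Qed.

Lemma derivation_comp t x s (f : hom C x s) (g : hom C t x) m : hdeg m f ->
  derivation d (comp f g) = comp (derivation d f) g + (-1) ^ m *: comp f (derivation d g).
Proof.
move=> Hf; have dl := derivation_is_linear.
apply: (eq_supported (P := fun p => path_deg p = m)
  (F := fun f : free_hom k G x s => derivation d (@comp k O C _ _ _ f g))
  (H := fun f => @comp k O C _ _ _ (derivation d (f : hom C x s)) g
     + (-1) ^ m *: @comp k O C _ _ _ f (derivation d g)) Hf).
- by apply: (is_linear_comp (dl _ _)); exact: (comp_linl HC).
- apply: is_linearD; last by apply: is_linearZ; exact: (comp_linl HC).
  by apply: (is_linear_comp (comp_linl HC _)); exact: dl.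
move=> p <- {m Hf}.
apply: (is_linear_eq (f := fun g : free_hom k G t x => derivation d (@comp k O C _ _ _ (elt p) g))
  (h := fun g => @comp k O C _ _ _ (derivation d (elt p)) g
     + (-1) ^ path_deg p *: @comp k O C _ _ _ (elt p) (derivation d (g : hom C t x)))).
- by apply: (is_linear_comp (dl _ _)); exact: (comp_linr HC).
- apply: is_linearD; first exact: (comp_linr HC).
  apply: is_linearZ; apply: (is_linear_comp (comp_linr HC _)); exact: dl.
move=> q; rewrite -![<< q >>]/(elt q) comp_elt !derivation_elt.
exact: derivation_path_cat.
Qed.

Lemma derivation_gen t s (b : basis G t s) : derivation d (elt (gcons b gnil)) = d b.
Proof.
rewrite derivation_elt -[derivation_path _ _]/(comp (d b) (idm t)
  + (-1) ^ bdeg b *: comp (elt (gcons b gnil)) (0 : hom C t t)).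
by rewrite (gcat_comp0r HC) scaler0 addr0 (comp_idr HC).
Qed.

End Derivation.

(** ** The universal property *)

Section Extension.
Variable D : gcat k O.
Hypothesis HD : is_gcat D.
Variable phi : forall t s, basis G t s -> hom D t s.
Hypothesis phi_deg : forall t s (b : basis G t s), hdeg (bdeg b) (phi b).

Lemma extension_elt t s (p : gpath (basis G) t s) : extension phi (elt p) = extension_path phi p.
Proof. by rewrite /extension /path_elt mlinU. Qed.

Lemma extension_path_cat t x s (p : gpath (basis G) x s) (q : gpath (basis G) t x) :
  extension_path phi (gcat_path p q) = comp (extension_path phi p) (extension_path phi q).
Proof.
elim: p q => [q|y w b p IHp q] /=; first by rewrite (comp_idl HD).
by rewrite IHp (comp_assoc HD).
Qed.

Lemma extension_path_deg t s (p : gpath (basis G) t s) : hdeg (path_deg p) (extension_path phi p).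
Proof.
elim: p => [|x y b q IHq] /=; first exact: (idm_deg HD).
exact: (comp_deg HD (phi_deg b) IHq).
Qed.

Lemma extension_gen t s (b : basis G t s) : extension phi (elt (gcons b gnil)) = phi b.
Proof. by rewrite extension_elt /= (comp_idr HD). Qed.

Lemma extension_is_gfunctor : is_gfunctor (fun t s => @extension k O G D phi t s).
Proof.
split.
- by move=> t s; exact: mlin_is_linear.
- move=> t s n f Hf; have gr := hom_grading HD t s.
  rewrite /extension /mlin big_seq; apply: (big_ind (fun u => hdeg n u)).
  + exact: (grading0 gr).
  + by move=> u v Hu Hv; rewrite -[u]scale1r; exact: (grading_lin gr).
  move=> p /Hf <-; rewrite -[_ *: _]addr0.
  by apply: (grading_lin gr); [exact: extension_path_deg | exact: (grading0 gr)].
- by move=> t; exact: extension_elt.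
- move=> t x s f g.
  apply: (is_linear_eq (f := fun f : free_hom k G x s => extension phi (@comp k O C _ _ _ f g))
    (h := fun f => comp (extension phi (f : hom C x s)) (extension phi g))).
  + by apply: is_linear_comp; [exact: mlin_is_linear | exact: (comp_linl HC)].
  + by apply: (is_linear_comp (comp_linl HD _)); exact: mlin_is_linear.
  move=> p.
  apply: (is_linear_eq
    (f := fun g : free_hom k G t x => extension phi (@comp k O C _ _ _ (elt p) g))
    (h := fun g => comp (extension phi (elt p)) (extension phi (g : hom C t x)))).
  + by apply: is_linear_comp; [exact: mlin_is_linear | exact: (comp_linr HC)].
  + by apply: (is_linear_comp (comp_linr HD _)); exact: mlin_is_linear.
  move=> q; rewrite -![<< q >>]/(elt q) comp_elt !extension_elt.
  exact: extension_path_cat.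
Qed.

End Extension.

Lemma free_genE t s (b : basis G t s) : free_gen (<< b >> : gspace k G t s) = elt (gcons b gnil).
Proof. exact: mlinU. Qed.

Theorem free_cat_is_free : is_free_on (C := C) (fun t s v => free_gen v).
Proof.
split.
- by move=> t s; exact: mlin_is_linear.
- move=> t s n v Hv.
  apply: (supported_mlin (P := fun p => path_deg p = n) (Q := fun b => bdeg b = n)) Hv => b db.
  by apply: supportedU; rewrite /= addr0.
move=> D phi HD phil phid; pose phi' t s (b : basis G t s) := phi t s << b >>.
have phi'd t s (b : basis G t s) : hdeg (bdeg b) (phi' t s b).
  by apply: phid => c; rewrite msuppU oner_eq0 inE => /eqP ->.
exists (fun t s => @extension k O G D phi' t s); split.
- exact: extension_is_gfunctor.
- move=> t s.
  apply: (is_linear_eq (f := fun v : gspace k G t s => extension phi' (free_gen v)) (h := phi t s)).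
  + by apply: is_linear_comp; exact: mlin_is_linear.
  + exact: phil.
  by move=> b; rewrite free_genE extension_gen.
move=> F [Fl _ F1 FM] Fi t s.
apply: (is_linear_eq (f := F t s) (h := @extension k O G D phi' t s)).
- exact: Fl.
- exact: mlin_is_linear.
move=> p; rewrite -[<< p >>]/(elt p) extension_elt.
elim: p => [|x y b q IHq] /=; first exact: F1.
by rewrite -IHq /phi' -Fi free_genE -FM comp_elt.
Qed.

End FreeCategory.

(** * The cobar construction of K as a complex of words *)

(** The contracted edges as a plain set, detached from the two trees. *)
HB.lock Definition names (I : finType) (t s : tree_class I) (h : mor t s) : {set {set I}} := val h.

Section TreePaths.
Variables (k : fieldType) (I : finType).
Local Notation T := (tree_class I).
Local Notation Y := {set I}.
Local Notation G := (cobar_graph (Kcocat k I)).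
Local Notation path := (gpath (basis G)).
Implicit Types (t s x : T) (w : seq {set Y}).

Lemma namesE t s (h : mor t s) : val h = names h.
Proof. by rewrite names.unlock. Qed.

Lemma names_inj t s : injective (@names I t s).
Proof. by move=> h h'; rewrite names.unlock => /val_inj. Qed.

Lemma names_sub t s (h : mor t s) : names h \subset edges t.
Proof. by rewrite -namesE; have /andP[] := valP h. Qed.

Lemma contract_names t s (h : mor t s) : contract_class t (names h) = s.
Proof. by rewrite -namesE; have /andP[_ /eqP] := valP h. Qed.

Lemma edges_mor t s (h : mor t s) : edges s = edges t :\: names h.
Proof. by rewrite -edges_contract contract_names. Qed.

Lemma names_id t : names (mor_id t) = set0.
Proof. by rewrite -namesE. Qed.

Lemma names_comp t x s (c : mor x s) (h : mor t x) : names (mor_comp c h) = names h :|: names c.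
Proof. by rewrite -!namesE. Qed.

Lemma names_disjoint t x s (c : mor x s) (h : mor t x) : [disjoint names h & names c].
Proof.
have := names_sub c; rewrite (edges_mor h) subsetD => /andP[_].
by rewrite disjoint_sym.
Qed.

(** Contracting a nonempty set of edges changes the tree; the generators of Omega(K),
    which join different trees, therefore have nonempty blocks. *)
Lemma names_eq0 t s (h : mor t s) : (names h == set0) = (t == s).
Proof.
apply/eqP/eqP => [h0|ts]; first by rewrite -(contract_names h) h0 contract0.
have Ee := edges_mor h; apply/setP => X; rewrite in_set0; apply/negP => Xh.
by have := subsetP (names_sub h) X Xh; rewrite ts Ee inE Xh.
Qed.

Definition gen_names x s (b : basis G x s) : {set Y} := names (val b).

Fixpoint blocks t s (p : path t s) : seq {set Y} :=
  match p with gnil => [::] | gcons x s b q => gen_names b :: blocks q end.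

Fixpoint path_mor t s (p : path t s) : mor t s :=
  match p with gnil => mor_id t | gcons x s b q => mor_comp (val b) (path_mor q) end.

Lemma gen_names_split t x s (b : basis G x s) (h : mor t s) (h' : mor t x) :
  [/\ gen_names b != set0, gen_names b \subset names h & names h :\: gen_names b = names h'].
Proof.
rewrite (mor_unique h (mor_comp (val b) h')) names_comp; split.
- by rewrite names_eq0; exact: (valP b).
- exact: subsetUr.
by rewrite setDUl setDv setU0; apply/setDidPl; exact: names_disjoint.
Qed.

Lemma bdeg_gen x s (b : basis G x s) : bdeg b = #|gen_names b|%:Z - 1.
Proof. by rewrite /gen_names -namesE. Qed.

Lemma blocks_composition t s (p : path t s) (h : mor t s) :
  homog_composition (names h) (path_deg p) (blocks p).
Proof.
rewrite /homog_composition; apply/andP; split; last first.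
  by apply/eqP; elim: p {h} => //= x y b q ->; rewrite /gen_names -namesE.
elim: p h => [|x y b q IHq] h /=; first by rewrite names_eq0.
have [b0 bh ->] := gen_names_split b h (path_mor q).
by rewrite b0 bh IHq.
Qed.

(** The ends are allowed to differ because the induction removes the last step: the
    source of that step is known only through the remaining blocks. *)
Lemma blocks_inj_tagged t s s' (p : path t s) (p' : path t s') : blocks p = blocks p' ->
  Tagged (path t) p = Tagged (path t) p'.
Proof.
elim: p s' p' => [|x y b q IHq] s' [|x' y' b' q'] //= [E /IHq Eq].
have Ex : x = x' := congr1 tag Eq.
case: x' / Ex b' q' E Eq => b' q' E /eqP; rewrite eq_Tagged => /eqP /= <- {q'}.
have Ey : y = y' by rewrite -(contract_names (val b)) -(contract_names (val b')) -!/(gen_names _) E.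
by case: y' / Ey b' E => b' /names_inj/val_inj ->.
Qed.

Lemma blocks_inj t s : injective (@blocks t s).
Proof. by move=> p p' /blocks_inj_tagged/eqP; rewrite eq_Tagged => /eqP. Qed.

(** The blocks are contracted from the last one to the first; the trees passed are
    determined by the union of the blocks contracted so far. *)
Lemma blocks_surj t s (h : mor t s) w :
  composition (names h) w -> exists p : path t s, blocks p == w.
Proof.
elim: w s h => [|B w IHw] s h /=.
  by rewrite names_eq0 => /eqP E; case: _ / E h => h; exists gnil.
case/and3P => B0 Bh Cw; have Gh : names h :\: B \subset val h by rewrite namesE subsetDl.
have BE : names h :\: (names h :\: B) = B by rewrite setDDr setDv set0U (setIidPr Bh).
pose x := contract_class t (names h :\: B).
pose h' : mor t x := Sub (names h :\: B) (split_right_subproof Gh).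
have bP : (B \subset edges x) && (contract_class x B == s).
  by have := split_left_subproof Gh; rewrite namesE BE.
pose c : mor x s := Sub B bP.
have xs : x != s by rewrite -(names_eq0 c) -namesE.
have [|q /eqP Eq] := IHw x h'; first by rewrite -namesE.
by exists (gcons (Sub c xs : basis G x s) q); rewrite /= Eq /gen_names -namesE.
Qed.

End TreePaths.

(** ** Encoding of paths by words *)

Section Encoding.
Variables (k : fieldType) (I : finType).
Local Notation T := (tree_class I).
Local Notation Y := {set I}.
Local Notation G := (cobar_graph (Kcocat k I)).
Local Notation path := (gpath (basis G)).
Variable A : free_space k (seq {set Y}).
Implicit Types (t s x : T) (w : seq {set Y}).

Definition encode t s (f : hom (free_cat k G) t s) : A :=
  mlin (fun p : path t s => elt (blocks p)) f.

Lemma encode_is_linear t s : is_linear (@encode t s).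
Proof. exact: mlin_is_linear. Qed.

Lemma encode_elt t s (p : path t s) : encode (path_elt k p) = elt (blocks p).
Proof. exact: mlinU. Qed.

Section Decode.
Variables (t s : T) (h : mor t s).

(** The words that are not ordered partitions of the contracted set are sent to 0. *)
Definition decode_word w : hom (free_cat k G) t s :=
  if @idP (composition (names h) w) is ReflectT c
  then path_elt k (xchoose (blocks_surj k c)) else 0.

Definition decode : {linear A -> hom (free_cat k G) t s} := ext decode_word.

Lemma decode_blocks (p : path t s) : decode (elt (blocks p)) = path_elt k p.
Proof.
rewrite /decode extE /decode_word; case: {-}_ / idP => [c|]; last first.
  by have /andP[] := blocks_composition p h.
by congr path_elt; apply: blocks_inj; apply/eqP; exact: (xchooseP (blocks_surj k c)).
Qed.

Lemma encodeK f : decode (encode f) = f.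
Proof.
apply: (is_linear_eq (f := fun f : free_hom k G t s => decode (encode f)) (h := id)) => //.
  by apply: is_linear_lin; exact: encode_is_linear.
move=> p; rewrite -[<< p >>]/(path_elt k p) encode_elt.
exact: decode_blocks.
Qed.

Lemma decode_word_blocks w : composition (names h) w ->
  exists2 p : path t s, blocks p = w & decode (elt w) = path_elt k p.
Proof. by move=> /(blocks_surj k)[p /eqP <-]; exists p => //; exact: decode_blocks. Qed.

Lemma decodeK n a : spanned (homog_composition (names h) n) a -> encode (decode a) = a.
Proof.
move=> Sa; apply: (eq_spanned (f := fun a => encode (decode a)) (h := id) Sa) => //.
  by apply: (is_linear_comp (@encode_is_linear t s)); exact: is_linearP.
move=> w /andP[/decode_word_blocks[p <- ->] _].
exact: encode_elt.
Qed.

Lemma spanned_encode n (f : hom (free_cat k G) t s) :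
  hdeg n f -> spanned (homog_composition (names h) n) (encode f).
Proof.
move=> Hf; rewrite /encode /mlin big_seq; apply: spanned_sum => p /Hf dp; apply: spannedZ.
by apply: spanned_elt; rewrite -dp; exact: blocks_composition.
Qed.

Lemma hdeg_decode n a : spanned (homog_composition (names h) n) a -> hdeg n (decode a).
Proof.
move=> Sa; apply: (Sa (fun a => hdeg n (decode a))).
- by rewrite linear0; exact: (grading0 (hom_grading (free_cat_is_gcat k G) t s)).
- move=> c u v Hu Hv; rewrite linearP.
  exact: (grading_lin (hom_grading (free_cat_is_gcat k G) t s)).
move=> w /andP[/decode_word_blocks[p Ew ->] /eqP dw].
apply: (supportedU (P := fun p => path_deg p = n)).
by rewrite -dw -Ew; have /andP[_ /eqP] := blocks_composition p h.
Qed.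

End Decode.

(** A path from t to s gives a morphism, so that a nonzero element can be decoded. *)
Lemma no_mor_hom t s (f : hom (free_cat k G) t s) : f = 0 \/ inhabited (mor t s).
Proof.
have [E|[p _]] := fset_0Vmem (msupp (f : free_hom k G t s)).
  by left; apply/(malgP (f : {malg k[path t s]}) 0) => p; rewrite mcoeff0 mcoeff_outdom // E.
by right; constructor; exact: path_mor p.
Qed.

Lemma encode_inj0 t s (f : hom (free_cat k G) t s) : encode f = 0 -> f = 0.
Proof.
have [//|[h] Ef] := no_mor_hom f.
by rewrite -(encodeK h f) Ef linear0.
Qed.

End Encoding.

(** ** The differential of words *)

Section ChainMap.
Variables (k : fieldType) (I : finType).
Local Notation T := (tree_class I).
Local Notation Y := {set I}.
Local Notation K := (Kcocat k I).
Local Notation G := (cobar_graph K).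
Local Notation path := (gpath (basis G)).
Variable A : free_space k (seq {set Y}).
Implicit Types (t s x : T) (w : seq {set Y}).

(** The image of the term a (x) c of a co-composition, preceding the word [w]. It
    depends only on the edges contracted by a and c, and vanishes on the diagonal,
    where only the reduced co-composition contributes. *)
Definition split_term w (L H : {set Y}) : A :=
  if (L != set0) && (H != set0) then (-1) ^+ #|L|.+1 *: elt (L :: H :: w) else 0.

Lemma to_offdiag_diag t s (b : basis K t s) : t = s -> to_offdiag b = None.
Proof. by move=> E; rewrite /to_offdiag insubF // E eqxx. Qed.

Definition tensor_elt t x s (a : basis K x s) (c : basis K t x) : tensor_basis K t s :=
  existT (fun x => (basis K x s * basis K t x)%type) x (a, c).

Lemma cobar_term_diag t x s (a : basis K x s) (c : basis K t x) : (x == s) || (t == x) ->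
  cobar_term (tensor_elt a c) = 0.
Proof.
rewrite /cobar_term /=; case/orP => /eqP E; first by rewrite (to_offdiag_diag a E).
by rewrite (to_offdiag_diag c E); case: (to_offdiag a).
Qed.

Lemma cobar_term_offdiag t x s (a : basis (offdiag K) x s) (c : basis (offdiag K) t x) :
  cobar_term (tensor_elt (val a) (val c)) =
  (-1) ^ (bdeg (val a) + 1) *: path_elt (G := G) k (gcons a (gcons c gnil)).
Proof.
have Ea : to_offdiag (val a) = Some a := valK a.
have Ec : to_offdiag (val c) = Some c := valK c.
rewrite /cobar_term /tensor_elt.
rewrite Ea.
rewrite Ec.
by [].
Qed.

Lemma encodeZ t s (e : k) (f : hom (free_cat k G) t s) : encode A (e *: f) = e *: encode A f.
Proof. by rewrite /encode linearZ. Qed.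

Lemma encode0 t s : encode A (0 : hom (free_cat k G) t s) = 0.
Proof. by rewrite /encode linear0. Qed.

Lemma encodeD t s (f g : hom (free_cat k G) t s) : encode A (f + g) = encode A f + encode A g.
Proof. by rewrite /encode linearD. Qed.

Lemma encode_cobar_term t y x s (a : basis K x s) (c : basis K y x) (q : path t y) :
  encode A (comp (cobar_term (tensor_elt a c)) (path_elt k q)) =
  split_term (blocks q) (names a) (names c).
Proof.
have HC := free_cat_is_gcat k G.
rewrite /split_term !names_eq0; case: ifP => [/andP[xs yx]|/negbT]; last first.
  by rewrite negb_and !negbK => /cobar_term_diag ->; rewrite (gcat_comp0l HC) encode0.
have -> : a = val (Sub a xs : basis (offdiag K) x s) by [].
have -> : c = val (Sub c yx : basis (offdiag K) y x) by [].
rewrite cobar_term_offdiag (gcat_compZl HC) comp_elt encodeZ encode_elt.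
have -> : bdeg (a : basis K x s) + 1 = Posz #|names a|.+1 by rewrite -namesE -addn1 PoszD.
by rewrite /gen_names.
Qed.

Lemma names_left_factor t s (h : mor t s) p (sigma : 'S_#|val h|) :
  names (left_factor h p sigma) = shuffle_left p sigma.
Proof. by rewrite -namesE. Qed.

Lemma names_right_factor t s (h : mor t s) p (sigma : 'S_#|val h|) :
  names (right_factor h p sigma) = shuffle_right p sigma.
Proof. by rewrite -namesE. Qed.

Section CobarGen.
Variables (t x s : T) (q : path t x).

Definition cobar_image : {linear {malg k[tensor_basis K x s]} -> A} :=
  mlin (fun u => encode A (comp (cobar_term u) (path_elt k q))).

Lemma cobar_imageU y (a : basis K y s) (c : basis K x y) :
  cobar_image << tensor_elt a c >> = split_term (blocks q) (names a) (names c).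
Proof. by rewrite /cobar_image /= mlinU encode_cobar_term. Qed.

Lemma cobar_imageZ c u : cobar_image (c *: u) = c *: cobar_image u.
Proof. exact: linearZ. Qed.

(** The two unit terms of the co-composition do not contribute, and the shuffles sum
    up to the splittings. *)
Lemma cobar_image_cocomp (h : mor x s) : names h != set0 ->
  cobar_image (Kcocomp k h) =
  split_sum (names h) (fun L H => split_sign k L H *: elt [:: L, H & blocks q]).
Proof.
move=> h0; have n0 : (#|val h| == 0%N) = false by rewrite namesE cards_eq0 (negbTE h0).
rewrite /Kcocomp n0 -namesE.
have E u v z : cobar_image u = 0 -> cobar_image v = 0 -> cobar_image (u + v + z) = cobar_image z.
  by move=> Eu Ev; rewrite !linearD Eu Ev !add0r.
have El : cobar_image << left_unit_term h >> = 0.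
  apply: (etrans (cobar_imageU (mor_id s : basis K s s) (h : basis K x s))).
  by rewrite /split_term names_id eqxx.
have Er : cobar_image << right_unit_term h >> = 0.
  apply: (etrans (cobar_imageU (h : basis K x s) (mor_id x : basis K x x))).
  by rewrite /split_term names_id eqxx andbF.
rewrite (E _ _ _ El Er) linear_sum.
transitivity (\sum_(1 <= p < #|val h|) \sum_(sigma : 'S_#|val h| | is_shuffle p sigma)
   (-1) ^+ odd_perm sigma *: split_term (blocks q) (shuffle_left p sigma) (shuffle_right p sigma)).
  apply: eq_bigr => p _; rewrite linear_sum; apply: eq_bigr => sigma _.
  apply: (etrans (cobar_imageZ _ _)); apply: (congr1 (fun v => (-1) ^+ odd_perm sigma *: v)).
  apply: (etrans (cobar_imageU (left_factor h p sigma : basis K _ s)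
    (right_factor h p sigma : basis K x _))).
  by rewrite names_left_factor names_right_factor.
rewrite sum_shuffles; apply: eq_split_sum => L H /and4P[L0 H0 _ _].
by rewrite /split_term L0 H0 scalerA -exprD addnC.
Qed.

Lemma cobar_imageE v :
  encode A (comp (mlin (@cobar_term k _ K x s) v) (path_elt k q)) = cobar_image v.
Proof.
move: v; apply: (is_linear_eq
  (f := fun v => encode A (comp (mlin (@cobar_term k _ K x s) v) (path_elt k q)))
  (h := cobar_image)).
- apply: (is_linear_comp (@encode_is_linear k I A t s)).
  apply: (is_linear_comp (comp_linl (free_cat_is_gcat k G) _)); exact: mlin_is_linear.
- exact: mlin_is_linear.
by move=> u; rewrite mlinU /cobar_image /= mlinU.
Qed.

Lemma encode_cobar_gen (b : basis G x s) :
  encode A (comp (cobar_gen b) (path_elt k q)) =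
  split_sum (gen_names b) (fun L H => split_sign k L H *: elt [:: L, H & blocks q]).
Proof.
rewrite /gen_names -cobar_image_cocomp; last by rewrite names_eq0; exact: (valP b).
exact: cobar_imageE.
Qed.

End CobarGen.

Lemma encode_gen_comp t x s (b : basis G x s) (g : hom (free_cat k G) t x) :
  encode A (comp (path_elt (G := G) k (gcons b gnil)) g) = block_mul A (gen_names b) (encode A g).
Proof.
apply: (is_linear_eq (f := fun g : free_hom k G t x =>
    encode A (@comp k _ (free_cat k G) _ _ _ (path_elt (G := G) k (gcons b gnil)) g))
  (h := fun g => block_mul A (gen_names b) (encode A (g : hom (free_cat k G) t x)))).
- apply: (is_linear_comp (@encode_is_linear k I A t s)); exact: (comp_linr (free_cat_is_gcat k G)).
- apply: is_linear_lin; exact: encode_is_linear.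
move=> q; rewrite -![<< q >>]/(path_elt k q) comp_elt !encode_elt block_mulE.
by [].
Qed.

Lemma gen_sign x s (b : basis G x s) : (-1) ^ bdeg b = block_sign k (gen_names b).
Proof.
have : names (val b) != set0 by rewrite names_eq0; exact: (valP b).
rewrite bdeg_gen /gen_names -card_gt0; rewrite /block_sign; case: #|_| => // n _.
rewrite (_ : n.+1%:Z - 1 = n); last by rewrite -addn1 PoszD addrK.
by rewrite !exprS !mulN1r opprK.
Qed.

Lemma encode_derivation_path t s (p : path t s) :
  encode A (derivation_path (@cobar_gen k _ K) p) = dword A (blocks p).
Proof.
elim: p => [|x y b q IHq]; first exact: encode0.
rewrite -[derivation_path _ _]/(comp (cobar_gen b) (path_elt k q)
  + (-1) ^ bdeg b *: comp (path_elt (G := G) k (gcons b gnil))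
      (derivation_path (@cobar_gen k _ K) q)).
apply: (etrans (encodeD _ _)).
have E1 := encode_cobar_gen q b.
have E2 := encode_gen_comp b (derivation_path (@cobar_gen k _ K) q).
have E3 := etrans (encodeZ ((-1) ^ bdeg b) _) (congr1 (fun v : A => (-1) ^ bdeg b *: v) E2).
rewrite {}E1 {}E3 IHq.
by rewrite gen_sign.
Qed.

Lemma encode_diff t s (f : hom (OmegaK k I) t s) : encode A (diff f) = dwords A (encode A f).
Proof.
apply: (is_linear_eq (f := fun f : free_hom k G t s =>
   encode A (derivation (@cobar_gen k _ K) (f : hom (free_cat k G) t s)))
  (h := fun f => dwords A (encode A (f : hom (free_cat k G) t s)))).
- apply: (is_linear_comp (@encode_is_linear k I A t s)); exact: mlin_is_linear.
- apply: is_linear_lin; exact: encode_is_linear.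
move=> p; rewrite -![<< p >>]/(path_elt k p) derivation_elt encode_elt dwordsE.
exact: encode_derivation_path.
Qed.

End ChainMap.

(** * The resolution *)

Fact malg_free_space (k : fieldType) (B : choiceType) : free_space k B.
Proof.
exact: (@FreeSpace k B ({malg k[B]} : lmodType k) (fun b => << b >>)
  (fun V f => mlin f) (fun V f b => mlinU f b)
  (fun V f h E g => @eq_linear k B V f h g (fun b _ => E b))).
Qed.

Lemma is_linear_scalel (k : fieldType) (U V : lmodType k) (L : U -> k^o) (v : V) :
  is_linear L -> is_linear (fun u => (L u : k) *: v).
Proof. by move=> Ll a u w; rewrite Ll scalerDl scalerA. Qed.

Section Singletons.
Variables (k : fieldType) (X : finType) (A : free_space k (seq {set X})).

Definition singleton_word (s : seq X) : seq {set X} := [seq [set x] | x <- s].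

Lemma singleton_word_composition s : uniq s ->
  homog_composition [set x in s] 0 (singleton_word s) && singletons (singleton_word s).
Proof.
rewrite /homog_composition; elim: s => [|x s IHs] /=.
  by rewrite eqxx !andbT => _; apply/eqP/setP => y; rewrite !inE.
case/andP => xs /IHs /andP[/andP[Cs /eqP ->] ->].
rewrite cards1 addr0 subrr eqxx !andbT; apply/and3P; split.
- by apply/set0Pn; exists x; rewrite set11.
- by rewrite sub1set !inE eqxx.
rewrite (_ : _ :\: _ = [set y in s]) //; apply/setP => y; rewrite !inE.
by case: eqP => [->|] //=; rewrite (negbTE xs).
Qed.

Lemma dword_singletons s : dword A (singleton_word s) = 0.
Proof. by elim: s => //= x s ->; rewrite split_sum1 linear0 scaler0 addr0. Qed.

End Singletons.

Section Main.
Variables (k : fieldType) (I : finType).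
Local Notation T := (tree_class I).
Local Notation Y := {set I}.
Local Notation K := (Kcocat k I).
Local Notation G := (cobar_graph K).
Local Notation path := (gpath (basis G)).
Local Notation Omega := (OmegaK k I).
Implicit Types (t s x : T).

Let A : free_space k (seq {set Y}) := malg_free_space k _.
Let HC : is_gcat (free_cat k G) := free_cat_is_gcat k G.

Lemma encode_inj t s : injective (@encode k I A t s).
Proof.
move=> f g E; apply/eqP; rewrite -subr_eq0; apply/eqP; apply: (@encode_inj0 k I A).
by rewrite -scaleN1r encodeD encodeZ E scaleN1r subrr.
Qed.

Lemma OmegaK_diff_deg t s n (f : hom Omega t s) : hdeg n f -> hdeg (n - 1) (diff f).
Proof.
move=> Hf; have [->|[h]] := no_mor_hom f.
  have -> : diff (0 : hom Omega t s) = 0 by apply: linear0.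
  exact: (grading0 (hom_grading HC t s)).
rewrite -(encodeK A h (diff f)); apply: hdeg_decode; rewrite encode_diff.
apply: (spanned_linear (f := dwords A) (@spanned_encode k I A t s h n f Hf)) => w Hw.
by rewrite dwordsE; exact: spanned_dword.
Qed.

(** The square of the differential vanishes because it does on words. *)
Theorem OmegaK_is_dgcat : is_dgcat Omega.
Proof.
split.
- exact: HC.
- by move=> t s; exact: derivation_is_linear.
- exact: OmegaK_diff_deg.
- by move=> t s f; apply: (@encode_inj0 k I A); rewrite !encode_diff dwords2.
- by move=> t x s f g m Hf; exact: (derivation_comp (@cobar_gen k _ K)).
Qed.

Lemma ktree_is_gcat : is_gcat (ktree k I).
Proof.
exact: (@linearization_is_gcat k T (fun t s => mor t s) (fun t s _ => 0) (@mor_id I)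
  (fun t x s F E => mor_comp F E) (fun t x y s f g h => mor_unique _ _)
  (fun t s f => mor_unique _ _) (fun t s f => mor_unique _ _) (fun t => erefl)
  (fun t x s f g => esym (addr0 _))).
Qed.

Let HK := ktree_is_gcat.

Theorem ktree_is_dgcat : is_dgcat (ktree k I).
Proof.
split.
- exact: HK.
- by move=> t s a u v; rewrite /= scaler0 addr0.
- by move=> t s n f _; exact: (grading0 (hom_grading HK t s)).
- by [].
- move=> t x s f g m _.
  transitivity (comp (0 : hom (ktree k I) x s) g
    + (-1) ^ m *: comp f (0 : hom (ktree k I) t x)); last by [].
  by rewrite (gcat_comp0l HK) (gcat_comp0r HK) scaler0 addr0.
Qed.

(** As there is at most one morphism from t to s, only the coefficient of the image of
    a path is to be found: it is 1 when all the generators are single edges. *)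
Lemma canonical_path t s (p : path t s) (h : mor t s) :
  extension_path (D := ktree k I) (@canonical_gen k I) p =
  (singletons (blocks p))%:R *: (<< h >> : ktree_hom k t s).
Proof.
elim: p h => [|x y b q IHq] h.
  by rewrite /= scale1r (mor_unique h (mor_id t)).
rewrite -[extension_path _ _]/(comp (canonical_gen b : hom (ktree k I) x y)
   (extension_path (D := ktree k I) (@canonical_gen k I) q)) (IHq (path_mor q)).
apply: (etrans (gcat_compZr HK _ _ _)).
have -> : comp (canonical_gen b : hom (ktree k I) x y) (<< path_mor q >> : ktree_hom k t x) =
    (#|gen_names b| == 1%N)%:R *: (<< h >> : ktree_hom k t y).
  rewrite /canonical_gen namesE -/(gen_names b); case: ifP => _; last first.
    by rewrite scale0r; exact: (gcat_comp0l HK).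
  rewrite scale1r (mor_unique h (mor_comp (val b) (path_mor q))).
  exact: (@linearization_compU k T (fun t s => mor t s) (fun t s _ => 0) (@mor_id I)
    (fun t x s F E => mor_comp F E)).
apply: (etrans (scalerA _ _ _)).
apply: (congr1 (fun c : k => c *: (<< h >> : ktree_hom k t y))).
rewrite -[singletons (blocks (gcons b q))]/((#|gen_names b| == 1%N) && singletons (blocks q)).
by case: (#|gen_names b| == 1%N); rewrite ?mulr1 ?mulr0.
Qed.

Lemma canonicalE t s (f : hom Omega t s) (h : mor t s) :
  canonical_functor f = (augment A (encode A f) : k) *: (<< h >> : ktree_hom k t s).
Proof.
apply: (is_linear_eq (f := fun f : free_hom k G t s => canonical_functor (f : hom Omega t s))
  (h := fun f => (augment A (encode A (f : hom Omega t s)) : k) *: (<< h >> : ktree_hom k t s))).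
- exact: mlin_is_linear.
- apply: (is_linear_scalel (L := fun f => augment A (encode A (f : hom Omega t s)))).
  by apply: is_linear_lin; exact: encode_is_linear.
move=> p; rewrite -![<< p >>]/(path_elt (G := G) k p) encode_elt augmentE.
by rewrite -(canonical_path p h); exact: extension_elt.
Qed.

Lemma canonical_gen_deg t s (b : basis G t s) :
  hdeg (bdeg b) (canonical_gen b : hom (ktree k I) t s).
Proof.
rewrite /canonical_gen; case: eqP => [b1|_]; last exact: (grading0 (hom_grading HK t s)).
move=> E _; by rewrite /= b1.
Qed.

Theorem canonical_is_dgfunctor : is_dgfunctor (@canonical_functor k I).
Proof.
split; first exact: (extension_is_gfunctor HK canonical_gen_deg).
move=> t s f; have [->|[h]] := no_mor_hom f.
  have -> : diff (0 : hom Omega t s) = 0 by apply: linear0.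
  by rewrite /= /canonical_functor /extension linear0.
rewrite (canonicalE (diff f) h) encode_diff [RHS]/= [X in X *: _](_ : _ = 0) ?scale0r //.
move: f; apply: (is_linear_eq (f := fun f : free_hom k G t s =>
   augment A (dwords A (encode A (f : hom Omega t s)))) (h := fun=> 0)).
- by apply: is_linear_lin; apply: is_linear_lin; exact: encode_is_linear.
- exact: is_linear0.
move=> p; rewrite -[<< p >>]/(path_elt (G := G) k p) encode_elt dwordsE.
by have /andP[Cp _] := blocks_composition p h; exact: augment_dword Cp.
Qed.

(** A cycle killed by the functor has augmentation 0, so it is a boundary. The
    morphism contracting E is the image of any path contracting the edges of E one by
    one, which is a cycle of degree 0. *)
Theorem canonical_is_quasi_iso : is_quasi_iso (@canonical_functor k I).
Proof.
move=> t s n; split.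
  move=> z Hz dz [w0 _]; rewrite [diff w0]/= => Fz.
  have [->|[h]] := no_mor_hom z.
    exists 0; first exact: (grading0 (hom_grading HC t s)).
    by apply: linear0.
  have az : augment A (encode A z) = 0.
    have /(congr1 (mcoeff h)) := canonicalE z h.
    by rewrite -Fz mcoeff0 mcoeffZ mcoeffUU mulr1.
  have [|b Sb db] := composition_exact (@spanned_encode k I A t s h n z Hz) _ az.
    by rewrite -encode_diff dz encode0.
  exists (decode A h b); first exact: hdeg_decode.
  by apply: encode_inj; rewrite encode_diff (decodeK Sb).
move=> y Hy _; have [E|[h hy]] := fset_0Vmem (msupp (y : {malg k[mor t s]})).
  have -> : y = 0.
    by apply/(malgP (y : {malg k[mor t s]}) 0) => p; rewrite mcoeff0 mcoeff_outdom // E.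
  exists 0; first by split; [exact: (grading0 (hom_grading HC t s)) | apply: linear0].
  exists 0; first exact: (grading0 (hom_grading HK t s)).
  by rewrite /canonical_functor /extension linear0 subr0.
have n0 := Hy h hy; rewrite -n0.
have /andP[Hw sw] := singleton_word_composition (enum_uniq (names h)).
rewrite set_enum in Hw.
pose c := (y : {malg k[mor t s]})@_h.
have Sw : spanned (homog_composition (names h) 0)
    (c *: (elt (singleton_word (enum (names h))) : A)).
  by apply: spannedZ; exact: spanned_elt.
exists (decode A h (c *: (elt (singleton_word (enum (names h))) : A))).
  split; first exact: hdeg_decode.
  apply: (@encode_inj t s); rewrite encode_diff (decodeK Sw) linearZ /= dwordsE.
  by rewrite dword_singletons scaler0 encode0.
exists 0; first exact: (grading0 (hom_grading HK t s)).
have Ec : augment A (c *: (elt (singleton_word (enum (names h))) : A)) = c.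
  by rewrite linearZ /= augmentE sw; exact: mulr1.
rewrite (canonicalE _ h) (decodeK Sw) Ec.
apply/esym/eqP; rewrite subr_eq0; apply/eqP; apply/(malgP (_ : {malg k[mor t s]}) y) => h'.
by rewrite (mor_unique h' h) mcoeffZ mcoeffUU mulr1.
Qed.

Theorem OmegaK_decomposable t s (v : gspace k G t s) : decomposable (diff (OmegaK_gen v)).
Proof.
rewrite /decomposable.
have -> : diff (OmegaK_gen v) = mlin (fun b : basis G t s => cobar_gen b) v.
  apply: (is_linear_eq (f := fun v : gspace k G t s => derivation (@cobar_gen k _ K) (free_gen v))
    (h := fun v => mlin (fun b : basis G t s => cobar_gen b) v)).
  - by apply: is_linear_comp; exact: mlin_is_linear.
  - exact: mlin_is_linear.
  by move=> b; rewrite free_genE mlinU; exact: derivation_gen.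
apply: (supported_mlin (P := fun p : path t s => (1 < path_length p)%N)
  (Q := fun=> True)) => // b _.
apply: (supported_mlin (Q := fun=> True)) => // -[x [a c]] _ /=.
case: (to_offdiag a) => [a'|]; last exact: supported0.
case: (to_offdiag c) => [c'|]; last exact: supported0.
by apply: supportedZ; apply: supportedU.
Qed.

End Main.

Theorem theorem3p2p3 (k : fieldType) (I : finType) (hI : (1 < #|I|)%N) :
  [/\ is_dgcat (OmegaK k I),
      is_dgcat (ktree k I),
      is_free_on (@OmegaK_gen k I),
      (forall (t s : tree_class I) (v : gspace k (cobar_graph (Kcocat k I)) t s),
         decomposable (diff (OmegaK_gen v))) &
      is_dgfunctor (@canonical_functor k I) /\ is_quasi_iso (@canonical_functor k I)].
Proof.
split.
- exact: OmegaK_is_dgcat.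
- exact: ktree_is_dgcat.
- exact: (free_cat_is_free k (cobar_graph (Kcocat k I))).
- exact: OmegaK_decomposable.
- by split; [exact: canonical_is_dgfunctor | exact: canonical_is_quasi_iso].
Qed.
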